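(* Let $d\in\mathbb{R}^n$. The Schur-Horn mapping $F: S_d\to M_d/\sim$ is a continuous mapping from $S_d$ to $M_d/\sim$ equipped with the Hausdorff distance $d_{\mathrm H}$.
   Context: For $x\in\mathbb{R}^n$, $x^{\uparrow}$ denotes $x$ reordered in non-decreasing order. For $a,\lambda\in\mathbb{R}^n$, $\lambda\prec a$ means $\sum_{i=1}^k \lambda_i^{\uparrow}\le \sum_{i=1}^k a_i^{\uparrow}$ for $k=1,\dots,n-1$ and $\sum_{i=1}^n\lambda_i^{\uparrow}=\sum_{i=1}^n a_i^{\uparrow}$. For a matrix $A$, $\mathrm{diag}(A)$ is the vector of its diagonal entries. For $d\in\mathbb{R}^n$, $S_d=\{\Lambda\in\mathbb{R}^{n\times n}:\Lambda \text{ diagonal},\ \mathrm{diag}(\Lambda)\prec d\}$, with distances measured in the Frobenius norm $\|\cdot\|_{\mathrm F}$, and $M_d=\{A\in\mathbb{R}^{n\times n}: \mathrm{diag}(A)=d,\ A=A^\top\}$. On $M_d$, $A_1\sim A_2$ if $A_1$ and $A_2$ have the same eigenvalues (with multiplicity); $[A]\subset M_d$ is the equivalence class of $A$. The Schur-Horn mapping is $F:S_d\to M_d/\sim$, $\Lambda\mapsto[Q\Lambda Q^\top]$, where $Q$ is an orthogonal matrix such that $\mathrm{diag}(Q\Lambda Q^\top)=d$ (such $Q$ exists by the Schur-Horn theorem). The Hausdorff distance on $M_d/\sim$ is $$d_{\mathrm H}([A_1],[A_2])=\max\Big\{\sup_{X\in[A_1]}\inf_{Y\in[A_2]}\|X-Y\|_{\mathrm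 F},\ \sup_{Y\in[A_2]}\inf_{X\in[A_1]}\|X-Y\|_{\mathrm F}\Big\}.$$ *)

(* Defs.v *)
From mathcomp Require Import all_boot all_order all_algebra.
From mathcomp Require Import all_classical all_reals ereal.

Set Implicit Arguments.
Unset Strict Implicit.
Unset Printing Implicit Defensive.

Import Order.TTheory GRing.Theory Num.Theory.
Local Open Scope classical_set_scope.
Local Open Scope ring_scope.

Section SchurHorn.
Context {R : realType} {n : nat}.
Implicit Types (d x a l : 'rV[R]_n) (A B X Y L Q : 'M[R]_n) (C : set 'M[R]_n).

Definition incr_sort x : seq R := sort <=%R [seq x 0 i | i <- enum 'I_n].

(* [majorized l a] is l ≺ a for the partial sums of the smallest entries:
   the sums of l lie below those of a, so l is the more spread-out vector. *)
Definition majorized l a : Prop :=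
  (forall k : nat, (0 < k < n)%N ->
     \sum_(i < k) (incr_sort l)`_i <= \sum_(i < k) (incr_sort a)`_i) /\
  \sum_(i < n) (incr_sort l)`_i = \sum_(i < n) (incr_sort a)`_i.

Definition diagv A : 'rV[R]_n := \row_i A i i.

Definition frob_norm A : R := Num.sqrt (\sum_i \sum_j A i j ^+ 2).

Definition S_set d : set 'M[R]_n :=
  [set L | is_diag_mx L /\ majorized (diagv L) d].

Definition M_set d : set 'M[R]_n := [set A | diagv A = d /\ A = A^T].

(* Multiplicities are those of real roots of the characteristic polynomial;
   symmetric matrices have no other eigenvalues. *)
Definition same_eigenvalues A B : Prop :=
  forall x : R, mup x (char_poly A) = mup x (char_poly B).

Definition eig_class d A : set 'M[R]_n :=
  [set B | M_set d B /\ same_eigenvalues A B].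

Definition M_quot d : set (set 'M[R]_n) :=
  [set C | exists2 A, M_set d A & C = eig_class d A].

Definition orthogonal_mx Q : Prop := Q *m Q^T = 1%:M.

Definition horn_mx d L : set 'M[R]_n :=
  [set Q | orthogonal_mx Q /\ diagv (Q *m L *m Q^T) = d].

(* The class does not depend on the Q chosen. For symmetric L, if [horn_mx d L]
   were empty then the default 1%:M would yield the empty set, which is not in
   [M_quot d]. *)
Definition schur_horn d L : set 'M[R]_n :=
  let Q := xget 1%:M (horn_mx d L) in eig_class d (Q *m L *m Q^T).

(* Extended-real suprema and infima, so that no boundedness or nonemptiness
   convention enters the definition. *)
Definition hausdorff_dist C1 C2 : \bar R :=
  maxe
    (ereal_sup [set ereal_inf [set (frob_norm (X - Y))%:E | Y in C2] | X in C1])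
    (ereal_sup [set ereal_inf [set (frob_norm (X - Y))%:E | X in C1] | Y in C2]).

End SchurHorn.

(* Main.v *)
Require Import Defs.
From mathcomp Require Import all_boot all_order all_fingroup all_algebra.
From mathcomp Require Import all_classical all_reals all_analysis.
From mathcomp Require Import ring lra.

(* For [L] in [S_set d], the class [schur_horn d L] is the set of all [Q L Q^T]
   with [Q] orthogonal and diagonal [d]; it is nonempty by Horn's theorem,
   because a Givens rotation through at most a quarter turn realizes every
   T-transform of the diagonal.

   By compactness of the orthogonal group, continuity reduces to a local
   statement: if [A] has diagonal [d] and the spectrum of [L], and [L'] in
   [S_set d] is close to [L], then some [A'] near [A] has diagonal [d] and the
   spectrum of [L'].  Split the coordinates into the connected components of the
   support graph of [A], all isolated vertices with the same diagonal entry
   being put together, and diagonalize [A] blockwise with eigenvalues [mu].  A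
   small rotation of the eigenvectors [i] and [j] lets diagonal mass flow from
   the class of [i] to that of [j] whenever [mu_i > mu_j].  The obstructions are
   the sets [S] of coordinates which mass cannot leave; they carry the smallest
   eigenvalues of [A].  Giving the eigenvectors in [S] the smallest eigenvalues
   of [L'] as well yields a matrix near [A] whose diagonal sum over each such [S]
   is, by majorization, at most that of [d]; hence the class sums of the diagonal
   can be corrected by small rotations.  Inside a connected class, small
   rotations along the edges then correct the single entries; on a class of
   isolated vertices [A] is a scalar matrix, so arbitrary rotations may be used. *)

Set Implicit Arguments.
Unset Strict Implicit.
Unset Printing Implicit Defensive.

Import Order.TTheory GRing.Theory Num.Theory.
Import numFieldNormedType.Exports.
Local Open Scope classical_set_scope.
Local Open Scope ring_scope.

(** * The Frobenius norm *)

Section Frobenius.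
Context {R : realType} {n : nat}.
Implicit Types (A B C X Y Q : 'M[R]_n) (c : R).

Lemma frob_ge0 X : 0 <= frob_norm X.
Proof. exact: sqrtr_ge0. Qed.

Lemma frob_sqr X : frob_norm X ^+ 2 = \sum_i \sum_j X i j ^+ 2.
Proof.
by rewrite sqr_sqrtr// sumr_ge0// => i _; rewrite sumr_ge0// => j _; rewrite sqr_ge0.
Qed.

Lemma frob_trace X : frob_norm X ^+ 2 = \tr (X *m X^T).
Proof.
rewrite frob_sqr /mxtrace; apply: eq_bigr => i _; rewrite mxE.
by apply: eq_bigr => j _; rewrite mxE expr2.
Qed.

Lemma eq_sqr_frob X Y :
  frob_norm X ^+ 2 = frob_norm Y ^+ 2 -> frob_norm X = frob_norm Y.
Proof. by move/eqP; rewrite eqrXn2 ?frob_ge0// => /eqP. Qed.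

Lemma frob_tr X : frob_norm X^T = frob_norm X.
Proof. by apply: eq_sqr_frob; rewrite !frob_trace trmxK mxtrace_mulC. Qed.

Lemma frobZ c X : frob_norm (c *: X) = `|c| * frob_norm X.
Proof.
apply/eqP; rewrite -(@eqrXn2 _ 2)// ?mulr_ge0 ?frob_ge0//.
rewrite exprMn !frob_sqr real_normK ?num_real// mulr_sumr; apply/eqP.
apply: eq_bigr => i _; rewrite mulr_sumr; apply: eq_bigr => j _.
by rewrite mxE exprMn.
Qed.

Lemma frobN X : frob_norm (- X) = frob_norm X.
Proof. by rewrite -scaleN1r frobZ normrN1 mul1r. Qed.

Lemma frobC X Y : frob_norm (X - Y) = frob_norm (Y - X).
Proof. by rewrite -frobN opprB. Qed.

Lemma ler_norm_frob X i j : `|X i j| <= frob_norm X.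
Proof.
rewrite -(@ler_pXn2r _ 2) ?nnegrE ?frob_ge0//.
rewrite frob_sqr real_normK ?num_real// (bigD1 i)//= (bigD1 j)//= -addrA lerDl.
rewrite addr_ge0 ?sumr_ge0// => [k _|k _]; first by rewrite sqr_ge0.
by rewrite sumr_ge0// => l _; rewrite sqr_ge0.
Qed.

(** Lagrange's identity: twice the difference of the two sides is the sum of the squares of all $a_i
    b_j - a_j b_i$. *)
Lemma cauchy_schwarz (I : finType) (a b : I -> R) :
  (\sum_i a i * b i) ^+ 2 <= (\sum_i a i ^+ 2) * (\sum_i b i ^+ 2).
Proof.
have : 0 <= \sum_i \sum_j (a i * b j - a j * b i) ^+ 2.
  by rewrite sumr_ge0// => i _; rewrite sumr_ge0// => j _; rewrite sqr_ge0.
suff -> : \sum_i \sum_j (a i * b j - a j * b i) ^+ 2 =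
    ((\sum_i a i ^+ 2) * (\sum_i b i ^+ 2)) *+ 2 - ((\sum_i a i * b i) ^+ 2) *+ 2.
  by rewrite -mulrnBl pmulrn_lge0// subr_ge0.
rewrite mulr2n {1}[X in X + _ - _]mulrC expr2 !big_distrlr/= -big_split/=.
rewrite -sumrMnl -sumrN -big_split/=; apply: eq_bigr => i _.
rewrite -big_split/= -sumrMnl -sumrN -big_split/=.
apply: eq_bigr => j _; ring.
Qed.

Lemma frobD X Y : frob_norm (X + Y) <= frob_norm X + frob_norm Y.
Proof.
rewrite -(@ler_pXn2r _ 2) ?nnegrE ?addr_ge0 ?frob_ge0//.
pose F Z (p : 'I_n * 'I_n) : R := Z p.1 p.2.
have frobF Z : frob_norm Z ^+ 2 = \sum_p F Z p ^+ 2.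
  by rewrite frob_sqr pair_big.
have CS : \sum_p F X p * F Y p <= frob_norm X * frob_norm Y.
  apply: le_trans (ler_norm _) _.
  rewrite -(@ler_pXn2r _ 2) ?nnegrE ?mulr_ge0 ?frob_ge0//.
  by rewrite real_normK ?num_real// exprMn !frobF cauchy_schwarz.
rewrite sqrrD frobF.
rewrite (_ : \sum_p _ = \sum_p F X p ^+ 2 + (\sum_p F X p * F Y p) *+ 2
                       + \sum_p F Y p ^+ 2); last first.
  rewrite -sumrMnl -!big_split/=; apply: eq_bigr => p _.
  by rewrite /F mxE sqrrD.
by rewrite -!frobF lerD2r lerD2l lerMn2r CS.
Qed.

Lemma frob_tri Y X Z : frob_norm (X - Z) <= frob_norm (X - Y) + frob_norm (Y - Z).
Proof. by apply: le_trans (frobD _ _); rewrite addrA subrK. Qed.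

Lemma frob_le_entries X c :
  0 <= c -> (forall i j, `|X i j| <= c) -> frob_norm X <= n%:R * c.
Proof.
move=> c0 Xc; rewrite -(@ler_pXn2r _ 2) ?nnegrE ?mulr_ge0 ?frob_ge0//.
rewrite frob_sqr exprMn.
apply: (@le_trans _ _ (\sum_(i < n) \sum_(j < n) c ^+ 2)).
  apply: ler_sum => i _; apply: ler_sum => j _.
  by rewrite -real_normK ?num_real// ler_pXn2r ?nnegrE.
by rewrite !sumr_const !card_ord -mulrnA -[leLHS]mulr_natl natrM expr2.
Qed.

Lemma frob_mulmx X Y : frob_norm (X *m Y) <= frob_norm X * frob_norm Y.
Proof.
rewrite -(@ler_pXn2r _ 2) ?nnegrE ?mulr_ge0 ?frob_ge0//.
rewrite exprMn !frob_sqr mulr_suml; apply: ler_sum => i _.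
rewrite [X in _ <= _ * X]exchange_big mulr_sumr; apply: ler_sum => j _.
by rewrite mxE; exact: cauchy_schwarz.
Qed.

End Frobenius.

(** * Orthogonal similarity *)

Definition osim {R : realType} {n : nat} (A B : 'M[R]_n) : Prop :=
  exists2 Q, orthogonal_mx Q & B = Q *m A *m Q^T.

Section OrthogonalSimilarity.
Context {R : realType} {n : nat}.
Implicit Types (A B C X P Q : 'M[R]_n).

Lemma orthogonal_mxC Q : orthogonal_mx Q -> Q^T *m Q = 1%:M.
Proof. exact: mulmx1C. Qed.

Lemma orthogonal_mxT Q : orthogonal_mx Q -> orthogonal_mx Q^T.
Proof. by rewrite /orthogonal_mx trmxK => /orthogonal_mxC. Qed.

Lemma orthogonal_mx1 : orthogonal_mx (1%:M : 'M[R]_n).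
Proof. by rewrite /orthogonal_mx trmx1 mulmx1. Qed.

Lemma orthogonal_mxM Q1 Q2 :
  orthogonal_mx Q1 -> orthogonal_mx Q2 -> orthogonal_mx (Q1 *m Q2).
Proof.
rewrite /orthogonal_mx => o1 o2.
by rewrite trmx_mul mulmxA -(mulmxA Q1) o2 mulmx1.
Qed.

Lemma frob_mulmxr X Q : orthogonal_mx Q -> frob_norm (X *m Q) = frob_norm X.
Proof.
move=> oQ; apply: eq_sqr_frob; rewrite !frob_trace trmx_mul mulmxA.
by rewrite -(mulmxA X) oQ mulmx1.
Qed.

Lemma frob_mulmxl X Q : orthogonal_mx Q -> frob_norm (Q *m X) = frob_norm X.
Proof.
move=> oQ; rewrite -frob_tr trmx_mul frob_mulmxr ?frob_tr//.
exact: orthogonal_mxT.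
Qed.

Lemma frob_conj X Q : orthogonal_mx Q -> frob_norm (Q *m X *m Q^T) = frob_norm X.
Proof.
by move=> oQ; rewrite frob_mulmxr ?frob_mulmxl//; exact: orthogonal_mxT.
Qed.

Lemma conj_mxB A B Q :
  Q *m A *m Q^T - Q *m B *m Q^T = Q *m (A - B) *m Q^T.
Proof. by rewrite mulmxBr mulmxBl. Qed.

Lemma conj_mxK A Q :
  orthogonal_mx Q -> Q^T *m (Q *m A *m Q^T) *m Q = A.
Proof.
move=> /orthogonal_mxC oQ.
by rewrite !mulmxA oQ mul1mx -mulmxA oQ mulmx1.
Qed.

Lemma conj_mxM A P Q :
  P *m (Q *m A *m Q^T) *m P^T = (P *m Q) *m A *m (P *m Q)^T.
Proof. by rewrite trmx_mul !mulmxA. Qed.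

Lemma osim_refl A : osim A A.
Proof.
by exists 1%:M; [exact: orthogonal_mx1 | rewrite trmx1 mulmx1 mul1mx].
Qed.

Lemma osim_sym A B : osim A B -> osim B A.
Proof.
move=> [Q oQ ->]; exists Q^T; first exact: orthogonal_mxT.
by rewrite trmxK conj_mxK.
Qed.

Lemma osim_trans B A C : osim A B -> osim B C -> osim A C.
Proof.
move=> [Q oQ ->] [P oP ->]; exists (P *m Q); first exact: orthogonal_mxM.
by rewrite conj_mxM.
Qed.

Lemma osim_symmetric A B : osim A B -> A = A^T -> B = B^T.
Proof. by move=> [Q _ ->] sA; rewrite !trmx_mul trmxK -sA mulmxA. Qed.

Lemma osim_char_poly A B : osim A B -> char_poly A = char_poly B.
Proof.
move=> [Q oQ ->]; rewrite /char_poly.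
have <- : map_mx (@polyC R) Q *m char_poly_mx A *m map_mx (@polyC R) Q^T =
    char_poly_mx (Q *m A *m Q^T).
  have e : map_mx (@polyC R) Q *m map_mx (@polyC R) Q^T = 1%:M.
    by rewrite -map_mxM oQ map_mx1.
  by rewrite /char_poly_mx mulmxBr mulmxBl !map_mxM scalar_mxC -(mulmxA 'X%:M) e mulmx1.
rewrite !det_mulmx mulrC mulrA -det_mulmx -map_mxM.
by rewrite (orthogonal_mxC oQ) map_mx1 det1 mul1r.
Qed.

Lemma is_diag_symmetric A : is_diag_mx A -> A = A^T.
Proof.
move=> /is_diag_mxP dA; apply/matrixP => i j; rewrite mxE.
by have [->//|ij] := eqVneq i j; rewrite !dA// eq_sym.
Qed.

Lemma perm_mx_orthogonal (s : 'S_n) : orthogonal_mx (perm_mx s : 'M[R]_n).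
Proof. by rewrite /orthogonal_mx tr_perm_mx -perm_mxM mulgV perm_mx1. Qed.

Lemma conj_perm_mxE A (s : 'S_n) i j :
  (perm_mx s *m A *m (perm_mx s)^T) i j = A (s i) (s j).
Proof.
rewrite -row_permE mxE (bigD1 (s j))//= !mxE eqxx mulr1 big1 ?addr0// => k ks.
by rewrite !mxE eq_sym (negPf ks) mulr0.
Qed.

Lemma osim_diag_perm (x : 'rV[R]_n) (s : 'S_n) :
  osim (diag_mx x) (diag_mx (\row_i x 0 (s i))).
Proof.
exists (perm_mx s); first exact: perm_mx_orthogonal.
by apply/matrixP => i j; rewrite conj_perm_mxE !mxE (inj_eq perm_inj).
Qed.

End OrthogonalSimilarity.

(** * Givens rotations and their effect on the diagonal *)

Definition moved {R : realType} {n : nat} (a : 'I_n -> R) i j m (b : 'I_n -> R) :=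
  forall k, b k = a k - m * ((k == i)%:R - (k == j)%:R).

Section Rotation.
Context {R : realType} {n : nat}.
Implicit Types (A B C X Q : 'M[R]_n) (i j k l : 'I_n) (t : R).

(** Rotation by [t] in the plane of the coordinates [i] and [j]. With the identity split off, its
    commutator with a fixed matrix is a combination with coefficients [cos t - 1] and [sin t]. *)
Definition givens i j t : 'M[R]_n :=
  1%:M + (cos t - 1) *: (delta_mx i i + delta_mx j j)
       + sin t *: (delta_mx i j - delta_mx j i).

Lemma givensM i j t (x : 'I_n -> R) k : i != j ->
  \sum_p givens i j t k p * x p =
    if k == i then cos t * x i + sin t * x j
    else if k == j then cos t * x j - sin t * x i else x k.
Proof.
move=> ij.
have dM (a b : 'I_n) : \sum_p (delta_mx a b : 'M[R]_n) k p * x p = (k == a)%:R * x b.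
  rewrite (bigD1 b)//= mxE eqxx andbT big1 ?addr0// => p pb.
  by rewrite mxE (negPf pb) andbF mul0r.
have -> : \sum_p givens i j t k p * x p = x k
  + (cos t - 1) * ((k == i)%:R * x i + (k == j)%:R * x j)
  + sin t * ((k == i)%:R * x j - (k == j)%:R * x i).
  rewrite -!dM -sumrN -!big_split/= !mulr_sumr.
  have -> : x k = \sum_p (k == p)%:R * x p.
    rewrite (bigD1 k)//= eqxx mul1r big1 ?addr0// => p pk.
    by rewrite eq_sym (negPf pk) mul0r.
  rewrite -!big_split/=; apply: eq_bigr => p _.
  by rewrite !mxE; ring.
have [->|ki] := eqVneq k i; first by rewrite ?eqxx (negPf ij) /=; ring.
by have [->|kj] := eqVneq k j; rewrite ?eqxx /=; ring.
Qed.

Lemma givens_mulE i j t X k l : i != j ->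
  (givens i j t *m X) k l =
    if k == i then cos t * X i l + sin t * X j l
    else if k == j then cos t * X j l - sin t * X i l else X k l.
Proof. by move=> ij; rewrite mxE givensM. Qed.

Lemma givens_conjE i j t X k l : i != j ->
  (givens i j t *m X *m (givens i j t)^T) k l =
    if l == i then cos t * (givens i j t *m X) k i + sin t * (givens i j t *m X) k j
    else if l == j then cos t * (givens i j t *m X) k j - sin t * (givens i j t *m X) k i
    else (givens i j t *m X) k l.
Proof.
move=> ij; rewrite mxE -(givensM _ (fun p => (givens i j t *m X) k p))//.
by apply: eq_bigr => p _; rewrite [(_^T) _ _]mxE mulrC.
Qed.

Lemma givens_orthogonal i j t : i != j -> orthogonal_mx (givens i j t).
Proof.
move=> ij; rewrite /orthogonal_mx -[X in X *m _](mulmx1 (givens i j t)).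
apply/matrixP => k l; rewrite givens_conjE// !givens_mulE// !mxE eqxx.
have cs := cos2Dsin2 t.
have ji : (j == i) = false by rewrite eq_sym (negPf ij).
have [ek|ki] := eqVneq k i; have [el|li] := eqVneq l i;
  have [ek'|kj] := eqVneq k j; have [el'|lj] := eqVneq l j;
  rewrite ?ek ?el ?ek' ?el' ?eqxx ?(negPf ij) ?ji ?(eq_sym i l) ?(eq_sym j l)
    ?(negPf li) ?(negPf ki) ?(negPf lj) ?(negPf kj) /=; try lra.
Qed.

(** The [i]-th diagonal entry of [A] after conjugation by [givens i j t]. The trace is kept and only
    two diagonal entries change, so it determines the new diagonal. *)
Definition givens_val A i j t : R :=
  cos t ^+ 2 * A i i + cos t * sin t * (A i j + A j i) + sin t ^+ 2 * A j j.

Lemma givens_moved A i j t : i != j ->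
  moved (fun k => A k k) i j (A i i - givens_val A i j t)
    (fun k => (givens i j t *m A *m (givens i j t)^T) k k).
Proof.
move=> ij k; rewrite givens_conjE// !givens_mulE// /givens_val.
have cs := cos2Dsin2 t.
have ji : (j == i) = false by rewrite eq_sym (negPf ij).
have [->|ki] := eqVneq k i; first by rewrite ?eqxx (negPf ij) /=; ring.
have [->|kj] := eqVneq k j; last by rewrite /=; ring.
have h1 := congr1 (fun z => z * A i i) cs.
have h2 := congr1 (fun z => z * A j j) cs.
by rewrite ?eqxx ?ji /=; lra.
Qed.

End Rotation.

(** * Lowering a diagonal entry by a small rotation *)

Section SmallRotations.
Context {R : realType} {n : nat}.
Implicit Types (A B C M X Q : 'M[R]_n) (i j k l : 'I_n) (t : R).

(** For the rotation $G$, right multiplication by $G$ keeps the norm and turns $GAG^T - A$ into the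
    commutator $GA - AG$, which tends to 0 with the angle. *)
Lemma givens_small A i j (e : R) : i != j -> 0 < e ->
  exists2 tau : R, 0 < tau & forall t, `|t| <= tau ->
    frob_norm (givens i j t *m A *m (givens i j t)^T - A) < e.
Proof.
move=> ij e0.
pose P : 'M[R]_n := delta_mx i i + delta_mx j j.
pose J : 'M[R]_n := delta_mx i j - delta_mx j i.
pose g t : R := `|cos t - 1| * frob_norm (P *m A - A *m P)
                 + `|sin t| * frob_norm (J *m A - A *m J).
have g0 : g 0 = 0 by rewrite /g cos0 sin0 subrr normr0 !mul0r addr0.
have gc : g t @[t --> (0 : R)] --> g 0.
  apply: cvgD; apply: cvgM; try exact: cvg_cst; apply: cvg_norm.
    by apply: cvgB; [exact: continuous_cos | exact: cvg_cst].
  exact: continuous_sin.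
have : \forall t \near (0 : R), g t < e by apply: cvgr_lt gc _ _; rewrite g0.
move=> /nbhs_ballP[r /= r0 gr]; exists (r / 2) => [|t tr]; first by rewrite divr_gt0.
apply: le_lt_trans (gr t _); last first.
  by rewrite -ball_normE /= sub0r normrN (le_lt_trans tr)// ltr_pdivrMr// ltr_pMr// ltr1n.
have oG := givens_orthogonal t ij.
rewrite -(frob_mulmxr (_ - A) oG) mulmxBl -(mulmxA (_ *m A)) (orthogonal_mxC oG) mulmx1.
have -> : givens i j t *m A - A *m givens i j t =
    (cos t - 1) *: (P *m A - A *m P) + sin t *: (J *m A - A *m J).
  rewrite /givens -/P -/J; clearbody P J.
  rewrite !mulmxDl !mulmxDr mul1mx mulmx1 -!scalemxAl -!scalemxAr !scalerBr.
  by rewrite opprD addrACA opprD [X in X + _ = _]addrACA subrr add0r.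
by rewrite /g -!frobZ frobD.
Qed.

Lemma givens_val0 A i j : givens_val A i j 0 = A i i.
Proof. by rewrite /givens_val cos0 sin0; ring. Qed.

Lemma continuous_givens_val A i j : continuous (givens_val A i j).
Proof.
move=> t; rewrite /givens_val; apply: cvgD; first apply: cvgD.
- by apply: cvgM; [apply: cvgM; exact: continuous_cos | exact: cvg_cst].
- apply: cvgM; last exact: cvg_cst.
  by apply: cvgM; [exact: continuous_cos | exact: continuous_sin].
- by apply: cvgM; [apply: cvgM; exact: continuous_sin | exact: cvg_cst].
Qed.

Lemma givens_val_IVT A i j t0 v : givens_val A i j t0 <= v <= A i i ->
  exists2 t, `|t| <= `|t0| & givens_val A i j t = v.
Proof.
rewrite -(givens_val0 A i j) => v0.
have cf a b : {within `[a, b], continuous (givens_val A i j)}.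
  by apply: continuous_subspaceT => x; exact: continuous_givens_val.
have [t0p|t0n] := leP 0 t0.
  have [|t] := IVT (v := v) t0p (cf _ _).
    by case/andP: v0 => v1 v2; rewrite ge_min le_max v1 v2 orbT.
  rewrite in_itv/= => /andP[t1 t2 <-]; exists t => //.
  by rewrite !ger0_norm.
have [|t] := IVT (v := v) (ltW t0n) (cf _ _).
  by case/andP: v0 => v1 v2; rewrite ge_min le_max v1 v2 orbT.
rewrite in_itv/= => /andP[t1 t2 <-]; exists t => //.
by rewrite !ler0_norm ?lerN2// ltW.
Qed.

(* A quarter turn exchanges the two diagonal entries, so every intermediate
   pair with the same sum occurs on the way, whatever the off-diagonal ones. *)
Lemma givens_exchange A i j m : i != j -> 0 <= m <= A i i - A j j ->
  exists t, moved (fun k => A k k) i j m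
    (fun k => (givens i j t *m A *m (givens i j t)^T) k k).
Proof.
move=> ij /andP[m0 m1].
have [|t _ tv] := @givens_val_IVT A i j (pi / 2) (A i i - m).
  by rewrite /givens_val cos_pihalf sin_pihalf; apply/andP; split; lra.
by exists t; have := givens_moved A t ij; rewrite tv opprB addrC subrK.
Qed.

(** The off-diagonal term is odd in [t], so the sign of the angle can be chosen to make it
    nonpositive; what remains is a loss of $\sin^2 t\,(A_{ii} - A_{jj})$. *)
Lemma givens_val_lt_diag A i j : A j j < A i i ->
  forall tau : R, 0 < tau -> exists2 t, `|t| <= tau & givens_val A i j t < A i i.
Proof.
move=> ji tau tau0.
pose t := Num.min tau 1.
have t0 : 0 < t by rewrite lt_min tau0 ltr01.
have tt : t <= tau by rewrite ge_min lexx.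
have s0 : 0 < sin t.
  apply: sin_gt0_pi; rewrite t0/= (@le_lt_trans _ _ 1) ?ge_min ?lexx ?orbT//.
  by have := pi_ge2 R; lra.
have s2 : 0 < sin t ^+ 2 by rewrite exprn_gt0.
have key : 0 < sin t ^+ 2 * (A i i - A j j) by rewrite mulr_gt0// subr_gt0.
have cs := congr1 (fun z => z * A i i) (cos2Dsin2 t).
have [off|off] := leP (cos t * sin t * (A i j + A j i)) 0.
  by exists t; [rewrite gtr0_norm | rewrite /givens_val; lra].
exists (- t); first by rewrite normrN gtr0_norm.
by rewrite /givens_val cosN sinN sqrrN; lra.
Qed.

(** Here the off-diagonal term is of first order in the angle and beats the quadratic diagonal term,
    whatever the sign of the latter. *)
Lemma givens_val_lt_offdiag A i j : A i j + A j i != 0 ->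
  forall tau : R, 0 < tau -> exists2 t, `|t| <= tau & givens_val A i j t < A i i.
Proof.
move=> a0 tau tau0; set a := A i j + A j i in a0.
have aa : 0 < `|a| by rewrite normr_gt0.
(* For small [t > 0] and a suitable sign of the angle, the entry drops by at least [sin t * g t]. *)
pose g t := cos t * `|a| - sin t * `|A i i - A j j|.
have gc : g t @[t --> (0 : R)] --> g 0.
  apply: cvgB; apply: cvgM; try exact: cvg_cst.
    exact: continuous_cos.
  exact: continuous_sin.
have : \forall t \near (0 : R), 0 < g t.
  by apply: cvgr_gt gc _ _; rewrite /g cos0 sin0 mul1r mul0r subr0.
move=> /nbhs_ballP[r /= r0 gr].
pose t := Num.min (Num.min tau 1) (r / 2).
have t0 : 0 < t by rewrite !lt_min tau0 ltr01 divr_gt0.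
have tt : t <= tau by rewrite !ge_min lexx.
have t1 : t <= 1 by rewrite !ge_min lexx ?orbT.
have tr : t < r.
  by rewrite (@le_lt_trans _ _ (r / 2)) ?ge_min ?lexx ?orbT//; lra.
have s0 : 0 < sin t.
  by apply: sin_gt0_pi; rewrite t0/= (le_lt_trans t1)//; have := pi_ge2 R; lra.
have gt0 : 0 < sin t * g t.
  by rewrite mulr_gt0//; apply: gr; rewrite -ball_normE /= sub0r normrN gtr0_norm.
have cs := congr1 (fun z => z * A i i) (cos2Dsin2 t).
have := ler_norm (- (A i i - A j j)); rewrite normrN => dd.
have s2 : 0 < sin t ^+ 2 by rewrite exprn_gt0.
have key := ler_wpM2l (ltW s2) dd.
rewrite /g in gt0.
have [an|ap] := leP a 0.
  exists t; first by rewrite gtr0_norm.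
  by rewrite ler0_norm// in gt0; rewrite /givens_val -/a; lra.
exists (- t); first by rewrite normrN gtr0_norm.
by rewrite gtr0_norm// in gt0; rewrite /givens_val -/a cosN sinN sqrrN; lra.
Qed.

End SmallRotations.

(** * Transfers of diagonal mass between classes of coordinates *)

Definition csum {R : realType} {n : nat} (cl : 'I_n -> 'I_n) (a : 'I_n -> R) k : R :=
  \sum_(l | cl l == cl k) a l.

(* For [cl = id] this is a transfer between single diagonal entries. *)
Definition transfers {R : realType} {n : nat} (cl : 'I_n -> 'I_n) (M : 'M[R]_n) i j :=
  forall e : R, 0 < e -> exists2 r : R, 0 < r &
    forall (B : 'M[R]_n) (m : R), frob_norm (B - M) < r -> 0 <= m < r ->
    exists B', [/\ osim B B', frob_norm (B' - M) < e &
      forall k, csum cl (fun l => B' l l) k = csum cl (fun l => B l l) k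
        - m * ((cl k == cl i)%:R - (cl k == cl j)%:R)].

Section Transfers.
Context {R : realType} {n : nat}.
Implicit Types (A B C M X Q : 'M[R]_n) (i j k l : 'I_n) (cl : 'I_n -> 'I_n).

Lemma csum_delta cl i k : csum cl (fun l => (l == i)%:R : R) k = (cl k == cl i)%:R.
Proof.
rewrite /csum; have [ki|ki] := eqVneq (cl k) (cl i).
  rewrite (bigD1 i) ?ki//= eqxx big1 ?addr0// => l /andP[_ /negPf ->//].
rewrite big1// => l /eqP lk; case: eqVneq => // li.
by rewrite -li lk eqxx in ki.
Qed.

Lemma moved_csum cl (a b : 'I_n -> R) i j m k : moved a i j m b ->
  csum cl b k = csum cl a k - m * ((cl k == cl i)%:R - (cl k == cl j)%:R).
Proof.
move=> ab; rewrite -!(csum_delta cl) /csum mulrBr !mulr_sumr -!sumrB.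
by apply: eq_bigr => l _; rewrite ab mulrBr.
Qed.

Lemma csum_id (a : 'I_n -> R) k : csum id a k = a k.
Proof. by rewrite /csum big_pred1_eq. Qed.

(** One small angle [t0] that lowers the entry of [M] also lowers that of every nearby [B] by a
    fixed amount; smaller losses occur at angles between 0 and [t0], by the intermediate value
    theorem. *)
Lemma givens_transfers cl M i j : i != j ->
  (forall tau : R, 0 < tau -> exists2 t, `|t| <= tau & givens_val M i j t < M i i) ->
  transfers cl M i j.
Proof.
move=> ij low e e0.
have e2 : 0 < e / 2 by rewrite divr_gt0.
have [tau tau0 small] := givens_small M ij e2.
have [t0 t0tau lowt0] := low _ tau0.
pose g := M i i - givens_val M i j t0; have g0 : 0 < g by rewrite subr_gt0.
(* Passing from [M] to [B] changes the entry by less than [g / 3] both before and after the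
   rotation, so at [t0] the entry of [B] still drops by more than [g / 3], hence by more than
   [m]. *)
exists (Num.min (e / 2) (g / 3)) => [|B m]; first by rewrite lt_min e2 divr_gt0.
rewrite !lt_min => /andP[Be Bg] /andP[m0 /andP[_ mg]].
have valE X : givens_val X i j t0 = (givens i j t0 *m X *m (givens i j t0)^T) i i.
  have := givens_moved X t0 ij i; rewrite eqxx (negPf ij) subr0 mulr1 => ->.
  by rewrite opprB addrC subrK.
have dval : `|givens_val B i j t0 - givens_val M i j t0| < g / 3.
  rewrite !valE; apply: le_lt_trans Bg.
  rewrite -(frob_conj _ (givens_orthogonal t0 ij)) -conj_mxB.
  by apply: le_trans (ler_norm_frob _ i i); rewrite !mxE.
have dii : `|B i i - M i i| < g / 3.
  apply: le_lt_trans Bg.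
  by apply: le_trans (ler_norm_frob _ i i); rewrite !mxE.
have [|t tt0 tv] := @givens_val_IVT _ _ B i j t0 (B i i - m).
  move: dval dii; rewrite !ltr_norml => /andP[_ d1] /andP[d2 _].
  by apply/andP; split; [rewrite /g in mg d1 d2 *; lra | lra].
have tt : `|t| <= tau by apply: le_trans tt0 _.
exists (givens i j t *m B *m (givens i j t)^T); split.
- by exists (givens i j t) => //; exact: givens_orthogonal.
- apply: le_lt_trans (frob_tri (givens i j t *m M *m (givens i j t)^T) _ _) _.
  rewrite conj_mxB frob_conj; last exact: givens_orthogonal.
  by have := small _ tt; lra.
- move=> k; apply: moved_csum; have := givens_moved B t ij.
  by rewrite tv opprB addrC subrK.
Qed.

Lemma transfers_refl cl M i j : cl i = cl j -> transfers cl M i j.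
Proof.
move=> ij e e0; exists e => // B m Be _; exists B; split => //.
  exact: osim_refl.
by move=> k; rewrite ij subrr mulr0 subr0.
Qed.

(** Transfers compose because their definition covers all [B] near [M]: the second one starts where
    the first one ends. *)
Lemma transfers_trans cl M j i k :
  transfers cl M i j -> transfers cl M j k -> transfers cl M i k.
Proof.
move=> ij jk e e0; have [r r0 jkr] := jk _ e0; have [s s0 ijs] := ij _ r0.
exists (Num.min r s) => [|B m]; first by rewrite lt_min r0.
rewrite !lt_min => /andP[Br Bs] /andP[m0 /andP[mr ms]].
have [|B1 [BB1 B1r B1d]] := ijs B m Bs; first by rewrite m0.
have [|B2 [BB2 B2r B2d]] := jkr B1 m B1r; first by rewrite m0.
exists B2; split => //; first exact: osim_trans BB2.
by move=> l; rewrite B2d B1d; ring.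
Qed.

Lemma transfers_connect cl M (T : rel 'I_n) i j :
  (forall i j, T i j -> transfers cl M i j) -> connect T i j ->
  transfers cl M i j.
Proof.
move=> TM /connectP[p]; elim: p i => [|x p IHp] i /=.
  by move=> _ ->; exact: transfers_refl.
move=> /andP[/TM ix xp] jl; apply: transfers_trans ix _.
exact: IHp.
Qed.

End Transfers.

(** * Compactness of the orthogonal group and blockwise diagonalization *)

Section OrthogonalCompact.
Context {R : realType} {n : nat}.
Implicit Types (A B Q : 'M[R]_n) (i j k l : 'I_n) (cl : 'I_n -> 'I_n).

Lemma continuous_sum_ord (T : topologicalType) (F : 'I_n -> T -> R) :
  (forall i, continuous (F i)) -> continuous (fun x => \sum_i F i x).
Proof. by move=> cF; apply: continuous_big => //; exact: add_continuous. Qed.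

Lemma continuous_mul (T : topologicalType) (f g : T -> R) :
  continuous f -> continuous g -> continuous (fun x => f x * g x).
Proof. by move=> cf cg x; apply: cvgM; [exact: cf | exact: cg]. Qed.

Lemma continuous_conj A i j : continuous (fun Q => (Q *m A *m Q^T) i j).
Proof.
have -> : (fun Q => (Q *m A *m Q^T) i j) =
    (fun Q => \sum_k (\sum_l Q i l * A l k) * Q j k).
  by apply/funext => Q; rewrite mxE; apply: eq_bigr => k _; rewrite !mxE.
have cQA k : continuous (fun Q : 'M[R]_n => \sum_l Q i l * A l k).
  apply: (@continuous_sum_ord _ (fun l Q => Q i l * A l k)) => l.
  by apply: continuous_mul; [exact: coord_continuous | exact: cst_continuous].
apply: (@continuous_sum_ord _ (fun k Q => (\sum_l Q i l * A l k) * Q j k)) => k.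
by apply: continuous_mul; [exact: cQA | exact: coord_continuous].
Qed.

Lemma closed_level (T : topologicalType) (f : T -> R) c :
  continuous f -> closed [set x | f x = c].
Proof.
move=> cf; apply: (@preimage_closed _ _ f [set y | y = c]); last exact: closed_eq.
by move=> x _; exact: cf.
Qed.

(** Tychonoff for a product of segments indexed by pairs, carried over by the continuous map that
    assembles a matrix from its entries. *)
Lemma mx_box_compact : compact [set Q : 'M[R]_n | forall i j, `|Q i j| <= 1].
Proof.
pose T := prod_topology (fun _ : 'I_n * 'I_n => R).
pose g (f : T) : 'M[R]_n := \matrix_(i, j) f (i, j).
have cg : continuous g.
  move=> f W /nbhs_ballP[e /= e0 eW].
  have H : nbhs f [set h : T | forall p, ball (f p) e (h p)].
    apply: (@filter_forall T _ (fun p => [set h : T | ball (f p) e (h p)]) (nbhs f)) => p.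
    exact: (@proj_continuous _ (fun=> R) p f _ (nbhsx_ballx (f p) e e0)).
  apply: filterS H => h H; apply: eW; split=> // i j.
  by rewrite !mxE; exact: H.
have cK : compact [set f : T | forall p, `[-1, 1]%classic (f p)].
  apply: (@tychonoff _ (fun=> R) (fun=> `[-1, 1]%classic)) => _.
  exact: segment_compact.
rewrite (_ : mkset _ = g @` [set f : T | forall p, `[-1, 1]%classic (f p)]).
  by apply: continuous_compact cK; exact: continuous_subspaceT.
apply/seteqP; split => Q /=.
  move=> Q1; exists (fun p => Q p.1 p.2) => /=.
    by move=> p; rewrite in_itv/= -ler_norml.
  by apply/matrixP => i j; rewrite mxE.
by move=> [f f1 <-] i j; rewrite mxE ler_norml; have := f1 (i, j); rewrite /= in_itv.
Qed.

Lemma orthogonal_entry_le1 Q i j : orthogonal_mx Q -> `|Q i j| <= 1.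
Proof.
move=> oQ; have := congr1 (fun M : 'M[R]_n => M i i) oQ; rewrite !mxE eqxx (bigD1 j)//=.
rewrite mxE -expr2 mulr1n => e; rewrite -(@ler_pXn2r _ 2) ?nnegrE// expr1n real_normK ?num_real//.
rewrite -e lerDl sumr_ge0// => k _; rewrite mxE -expr2; exact: sqr_ge0.
Qed.

(** Blocks are the fibres of a labelling, so they need not consist of consecutive indices. *)
Definition block_mx_on cl Q := forall i j, cl i != cl j -> Q i j = 0.

Lemma orthogonal_compact : compact [set Q : 'M[R]_n | orthogonal_mx Q].
Proof.
apply: subclosed_compact mx_box_compact _; last first.
  by move=> Q oQ i j; exact: orthogonal_entry_le1.
rewrite (_ : mkset _ = \bigcap_(p in setT)
    [set Q | (Q *m 1%:M *m Q^T) p.1 p.2 = (1%:M : 'M[R]_n) p.1 p.2]).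
  apply: closed_bigI => p _; apply: closed_level; exact: continuous_conj.
apply/seteqP; split => Q /=; first by move=> oQ [i j] _ /=; rewrite mulmx1 oQ.
by move=> oQ; apply/matrixP => i j; have := oQ (i, j) I; rewrite /= mulmx1.
Qed.

Lemma orthogonal_block_compact cl :
  compact [set Q | orthogonal_mx Q /\ block_mx_on cl Q].
Proof.
rewrite (_ : mkset _ = [set Q : 'M[R]_n | orthogonal_mx Q] `&`
    \bigcap_(p in [set p | cl p.1 != cl p.2]) [set Q : 'M[R]_n | Q p.1 p.2 = 0]).
  apply: compact_closedI; first exact: orthogonal_compact.
  by apply: closed_bigI => p _; apply: closed_level; exact: coord_continuous.
apply/seteqP; split => Q /= [oQ bQ]; split => //.
  by move=> [i j] ij; exact: bQ.
by move=> i j ij; exact: (bQ (i, j)).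
Qed.

Lemma block_conj cl A Q : block_mx_on cl A -> block_mx_on cl Q ->
  block_mx_on cl (Q *m A *m Q^T).
Proof.
move=> bA bQ i j ij; rewrite mxE big1// => k _; rewrite !mxE.
have [jk|jk] := eqVneq (cl j) (cl k); last by rewrite (bQ j k)// mulr0.
rewrite big1 ?mul0r// => l _.
have [il|il] := eqVneq (cl i) (cl l); last by rewrite (bQ i l)// mul0r.
by rewrite (bA l k) ?mulr0// -il -jk.
Qed.

(* A maximiser of the sum of the squared diagonal entries over the block
   orthogonal matrices is diagonal: a small rotation away from equal diagonal
   entries would increase it. *)
Lemma block_spectral cl A : A = A^T -> block_mx_on cl A ->
  exists Q, [/\ orthogonal_mx Q, block_mx_on cl Q & is_diag_mx (Q *m A *m Q^T)].
Proof.
move=> sA bA.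
pose f Q : R := \sum_i ((Q *m A *m Q^T) i i) ^+ 2.
have cf : continuous f.
  apply: (@continuous_sum_ord _ (fun i Q => ((Q *m A *m Q^T) i i) ^+ 2)) => i.
  by apply: continuous_mul; exact: continuous_conj.
have [||Q] := compact_EVT_max (f := f) _ (@orthogonal_block_compact cl).
- exists 1%:M; split; first exact: orthogonal_mx1.
  by move=> i j; rewrite mxE; case: (eqVneq i j) => // ->; rewrite eqxx.
- exact: continuous_subspaceT.
rewrite inE => -[oQ bQ] maxQ; exists Q; split => //.
set B := Q *m A *m Q^T; have sB : B = B^T by rewrite /B !trmx_mul trmxK -sA mulmxA.
have bB : block_mx_on cl B := block_conj bA bQ.
suff H i j : i != j -> B i i <= B j j -> B i j = 0.
  apply/is_diag_mxP => i j ij; have [|/ltW] := leP (B i i) (B j j); first exact: H.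
  by move=> /H <-; rewrite 1?eq_sym// [in LHS]sB mxE.
move=> ij Bij; apply: contrapT => /eqP nz.
have cij : cl i = cl j by apply: contra_neq_eq nz; exact: bB.
have nz2 : B i j + B j i != 0.
  have -> : B j i = B i j by rewrite [in LHS]sB mxE.
  by rewrite -mulr2n mulrn_eq0.
(* Lowering the smaller of the two entries spreads the pair apart at constant sum, which raises the
   sum of squares. *)
have [t _ lt] := givens_val_lt_offdiag nz2 (ltr01 : 0 < (1 : R)).
have mv := givens_moved B t ij; move: mv; set m := B i i - _ => mv.
have m0 : 0 < m by rewrite subr_gt0.
have : f (givens i j t *m Q) <= f Q.
  apply: maxQ; rewrite inE; split.
    by apply: orthogonal_mxM => //; exact: givens_orthogonal.
  move=> k l kl; rewrite givens_mulE//.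
  have [ki|_] := eqVneq k i.
    by rewrite !bQ ?mulr0 ?addr0// -?cij -?ki.
  have [kj|_] := eqVneq k j; last exact: bQ.
  by rewrite !bQ ?mulr0 ?subr0 ?cij -?kj.
suff -> : f (givens i j t *m Q) = f Q + (m ^+ 2 + m * (B j j - B i i)) *+ 2.
  have : 0 < (m ^+ 2 + m * (B j j - B i i)) *+ 2.
    by rewrite pmulrn_lgt0// ltr_pwDl ?exprn_gt0// mulr_ge0 ?subr_ge0// ltW.
  by move=> p; rewrite leNgt ltrDl p.
rewrite /f -conj_mxM -/B.
have -> : \sum_k ((givens i j t *m B *m (givens i j t)^T) k k) ^+ 2 =
    \sum_k (B k k - m * ((k == i)%:R - (k == j)%:R)) ^+ 2.
  by apply: eq_bigr => k _; rewrite mv.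
rewrite (bigD1 i)//= (bigD1 j) 1?eq_sym//= [in RHS](bigD1 i)//= [in RHS](bigD1 j) 1?eq_sym//=.
have ji : (j == i) = false by rewrite eq_sym (negPf ij).
rewrite ?eqxx ?(negPf ij) ?ji.
rewrite (eq_bigr (fun k => B k k ^+ 2)) => [|k /andP[/negPf -> /negPf ->]]; last first.
  by rewrite subrr mulr0 subr0.
rewrite /=; ring.
Qed.

(** The multiplicity of [z] as a root counts its occurrences among the entries, so the two tuples
    agree up to order. *)
Lemma osim_diag_perm_eq (x y : 'rV[R]_n) :
  (forall z, mup z (char_poly (diag_mx x)) = mup z (char_poly (diag_mx y))) ->
  exists s : 'S_n, forall i, y 0 i = x 0 (s i).
Proof.
have cp (u : 'rV[R]_n) : char_poly (diag_mx u) = \prod_(z <- [tuple u 0 i | i < n]) ('X - z%:P).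
  rewrite char_poly_trig ?diag_mx_is_trig// big_map big_enum/=.
  by apply: eq_bigr => i _; rewrite mxE eqxx.
move=> H; suff /tuple_permP[s es] : perm_eq [tuple y 0 i | i < n] [tuple x 0 i | i < n].
  exists s => i; have := congr1 (fun q => nth 0 q i) es.
  by rewrite -!tnth_nth !tnth_mktuple.
by apply/allP => z _ /=; rewrite -!mu_prod_XsubC -!cp H.
Qed.

End OrthogonalCompact.

(** * Majorization and sums over sets of smallest entries *)

Section Majorization.
Context {R : realType} {n : nat}.
Implicit Types (x l a d : 'rV[R]_n) (P Q : {set 'I_n}) (i j k : 'I_n).

(** Lays out the values of [x] in increasing order along a prescribed preorder [r] of the
    indices. *)
Lemma order_perm (r : rel 'I_n) (x : 'I_n -> R) : total r -> transitive r ->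
  exists (t : 'S_n) (s : seq 'I_n), [/\ perm_eq s (enum 'I_n), sorted r s,
    sorted <=%R [seq x (t i) | i <- s] &
    forall i j, ~~ r j i -> x (t i) <= x (t j)].
Proof.
move=> rtot rtr; set s1 := sort r (enum 'I_n).
pose q i j := x i <= x j.
have qtot : total q by move=> i j; exact: le_total.
have qtr : transitive q by move=> j i k; exact: le_trans.
set s2 := sort q (enum 'I_n).
have s1E : perm_eq s1 (enum 'I_n) by rewrite /s1 perm_sort.
have s2E : perm_eq s2 (enum 'I_n) by rewrite /s2 perm_sort.
have sz1 : size s1 = n by rewrite size_sort size_enum_ord.
have sz2 : size s2 = n by rewrite size_sort size_enum_ord.
have in1 i : i \in s1 by rewrite (perm_mem s1E) mem_enum.
have u1 : uniq s1 by rewrite (perm_uniq s1E) enum_uniq.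
have u2 : uniq s2 by rewrite (perm_uniq s2E) enum_uniq.
have idx i : (index i s1 < n)%N by rewrite -[X in (_ < X)%N]sz1 index_mem in1.
(* [f] sends the index of rank [k] for [r] to the index of rank [k] for [x]. *)
pose f i := nth i s2 (index i s1).
have f_inj : injective f.
  move=> i j; rewrite /f (set_nth_default j) ?sz2// => /eqP.
  rewrite nth_uniq ?sz2// => /eqP ij.
  by rewrite -(nth_index i (in1 i)) ij nth_index.
have fs : [seq f i | i <- s1] = s2.
  case: (posnP n) => [n0|n0].
    by apply: etrans (esym _); apply: size0nil; rewrite ?size_map ?sz1 ?sz2.
  apply: (@eq_from_nth _ (Ordinal n0)); first by rewrite size_map sz1 sz2.
  rewrite size_map sz1 => k kn; rewrite (nth_map (Ordinal n0)) ?sz1// /f.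
  by rewrite index_uniq ?sz1//; apply: set_nth_default; rewrite sz2.
exists (perm f_inj), s1; split => //.
- exact: sort_sorted.
- have -> : [seq x (perm f_inj i) | i <- s1] = [seq x i | i <- s2].
    by rewrite -fs -map_comp; apply: eq_map => i /=; rewrite permE.
  by rewrite sorted_map; apply: sort_sorted.
- move=> i j rji; rewrite !permE.
  have ij : (index i s1 <= index j s1)%N.
    rewrite leqNgt; apply: contra rji => ji.
    rewrite -(nth_index i (in1 j)) -[X in r _ X](nth_index i (in1 i)).
    apply: (sorted_ltn_nth rtr) => //; rewrite ?inE ?sz1 ?idx//.
    exact: sort_sorted.
  rewrite /f [X in _ <= x X](set_nth_default i) ?sz2//.
  apply: (@sorted_leq_nth _ q) => //; rewrite ?inE ?sz2 ?idx//.
    by move=> k; exact: lexx.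
  exact: sort_sorted.
Qed.

Definition lower_set (x : 'I_n -> R) P := forall i j, i \in P -> j \notin P -> x i <= x j.

(** After cancelling the common part, [P :\: Q] and [Q :\: P] have the same size, and the largest
    value on the first is at most every value on the second. *)
Lemma sum_lower_set (x : 'I_n -> R) P Q : #|P| = #|Q| -> lower_set x P ->
  \sum_(i in P) x i <= \sum_(i in Q) x i.
Proof.
move=> PQ lowP.
rewrite (big_setID Q)/= [leRHS](big_setID P)/= finset.setIC lerD2l.
have cD : #|P :\: Q| = #|Q :\: P|.
  by apply/eqP; rewrite -(eqn_add2l #|P :&: Q|) cardsID PQ finset.setIC cardsID.
have [e|/finset.set0Pn[p pD]] := eqVneq (P :\: Q) finset.set0.
  have e' : Q :\: P = finset.set0 by apply/eqP; rewrite -cards_eq0 -cD e cards0.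
  by rewrite e e' !big_set0.
have /= := @arg_maxP _ _ _ p (fun i => i \in P :\: Q) x pD.
case=> M MD Mmax.
apply: (@le_trans _ _ (\sum_(i in P :\: Q) x M)).
  by apply: ler_sum => i; exact: Mmax.
rewrite sumr_const cD -sumr_const; apply: ler_sum => i.
rewrite inE => /andP[iP _]; apply: lowP => //.
by move: MD; rewrite inE => /andP[].
Qed.

(** Turns partial sums of the sorted list into sums over index sets, the form in which majorization
    is used from here on. *)
Lemma incr_sort_lower_set x (m : nat) : (m <= n)%N -> exists P,
  [/\ #|P| = m, lower_set (x 0) P &
      \sum_(i < m) (incr_sort x)`_i = \sum_(i in P) x 0 i].
Proof.
move=> mn.
pose q i j := x 0 i <= x 0 j.
have qtot : total q by move=> i j; exact: le_total.
have qtr : transitive q by move=> j i k; exact: le_trans.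
set s := sort q (enum 'I_n).
have sE : perm_eq s (enum 'I_n) by rewrite /s perm_sort.
have sz : size s = n by rewrite size_sort size_enum_ord.
have us : uniq s by rewrite (perm_uniq sE) enum_uniq.
have ss : sorted q s by exact: sort_sorted.
have xs : incr_sort x = [seq x 0 i | i <- s] by rewrite /incr_sort sort_map.
have utm : uniq (take m s) by exact: take_uniq.
exists [set i in take m s]; split.
- by rewrite cardsE (card_uniqP utm) size_takel ?sz.
- move=> i j; rewrite !inE => im jm.
  have js : j \in drop m s.
    have : j \in s by rewrite (perm_mem sE) mem_enum.
    by rewrite -{1}(cat_take_drop m s) mem_cat (negPf jm).
  have := ss; rewrite -{1}(cat_take_drop m s) sorted_pairwise// pairwise_cat.
  by case/and3P => /allrelP/(_ i j im js).
- rewrite xs; have -> : \sum_(i in [set i in take m s]) x 0 i = \sum_(i <- take m s) x 0 i.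
    rewrite [RHS]big_uniq//=; apply: eq_bigl => i; by rewrite inE.
  rewrite -(big_map (fun i => x 0 i) xpredT id) map_take.
  set t := map _ s; have szt : (m <= size t)%N by rewrite size_map sz.
  rewrite (big_nth 0) size_takel// big_mkord; apply: eq_bigr => i _.
  by rewrite nth_take.
Qed.

Lemma sum_incr_sort x : \sum_(i < n) (incr_sort x)`_i = \sum_i x 0 i.
Proof.
have [P [cP _ ->]] := @incr_sort_lower_set x n (leqnn n).
have /eqP -> : P == finset.setT.
  by rewrite eqEcard finset.subsetT cardsT card_ord cP leqnn.
by apply: eq_bigl => i; rewrite inE.
Qed.

Lemma majorized_sum l a : majorized l a -> \sum_i l 0 i = \sum_i a 0 i.
Proof. by case=> _; rewrite !sum_incr_sort. Qed.

(** The sums of the [#|P|] smallest entries of [l] and of [a] lie between the two sides. *)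
Lemma majorized_lower_set l a (t : 'S_n) P : majorized l a ->
  lower_set (fun i => l 0 (t i)) P ->
  \sum_(i in P) l 0 (t i) <= \sum_(i in P) a 0 i.
Proof.
(* [majorized] gives inequalities only for lengths strictly between 0 and [n], so the empty and the
   full set are treated apart. *)
move=> la lowP; have [P0|P0] := posnP #|P|.
  by move/eqP: P0; rewrite cards_eq0 => /eqP ->; rewrite !big_set0.
have Pn : (#|P| <= n)%N by rewrite -[X in (_ <= X)%N]card_ord max_card.
have [Peq|Plt] := leqP n #|P|.
  have /eqP -> : P == finset.setT by rewrite eqEcard finset.subsetT cardsT card_ord.
  rewrite [leLHS](_ : _ = \sum_i l 0 i).
    by rewrite (majorized_sum la) le_eqVlt; apply/orP; left; apply/eqP;
       apply: eq_bigl => i; rewrite inE.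
  rewrite [RHS](reindex_perm t); apply: eq_bigl => i; by rewrite inE.
have [Q [cQ _ eQ]] := incr_sort_lower_set l Pn.
have [S [cS lowS eS]] := incr_sort_lower_set a Pn.
apply: (@le_trans _ _ (\sum_(i < #|P|) (incr_sort l)`_i)).
  rewrite eQ [leRHS](reindex_perm t)/=.
  rewrite [leRHS](_ : _ = \sum_(i in t @^-1: Q) l 0 (t i)); last first.
    by apply: eq_bigl => i; rewrite inE.
  apply: sum_lower_set => //; by rewrite card_preimset ?cQ//; exact: perm_inj.
apply: (@le_trans _ _ (\sum_(i < #|P|) (incr_sort a)`_i)).
  by apply: la.1; rewrite P0.
by rewrite eS; apply: sum_lower_set.
Qed.

End Majorization.

(** * Horn's theorem *)

Section Horn.
Context {R : realType} {n : nat}.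
Implicit Types (A B L : 'M[R]_n) (x l a d : 'rV[R]_n) (i j k : 'I_n).

Lemma sum_indic (p : pred 'I_n) i : \sum_(k | p k) (k == i)%:R = (p i)%:R :> R.
Proof.
case pi: (p i); last first.
  by rewrite big1// => k pk; case: eqVneq => // ki; rewrite -ki pk in pi.
by rewrite (bigD1 i)//= eqxx big1 ?addr0// => k /andP[_ /negPf ->].
Qed.

Lemma sum_moved (a b : 'I_n -> R) i j m (p : pred 'I_n) : moved a i j m b ->
  \sum_(k | p k) b k = \sum_(k | p k) a k - m * ((p i)%:R - (p j)%:R).
Proof.
move=> ab; rewrite -!sum_indic mulrBr !mulr_sumr -!sumrB.
by apply: eq_bigr => k _; rewrite ab mulrBr.
Qed.

(* Muirhead's argument: an excess at [j] is moved down to the nearest deficit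
   below it, which settles one of the two coordinates. *)
Lemma level_sums_horn d B :
  (forall c, \sum_(k | d 0 k <= c) (B k k - d 0 k) <= 0) ->
  \sum_k (B k k - d 0 k) = 0 ->
  exists2 B', osim B B' & diagv B' = d.
Proof.
have [N] := ubnP #|[set k | B k k != d 0 k]%SET|; elim: N B => // N IHN B cB low tot.
have [e|[j ej]] : diagv B = d \/ exists j, 0 < B j j - d 0 j.
  have [[j ?]|none] := pselect (exists j, 0 < B j j - d 0 j); [by right; exists j|left].
  have le0 k : B k k - d 0 k <= 0 by rewrite leNgt; apply/negP => k0; apply: none; exists k.
  apply/rowP => k; rewrite mxE; apply/eqP; rewrite -subr_eq0 -oppr_eq0; apply/eqP.
  apply: (psumr_eq0P (P := xpredT) (F := fun k => - (B k k - d 0 k))) => //.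
    by move=> i _; rewrite oppr_ge0.
  by rewrite sumrN tot oppr0.
- by exists B => //; exact: osim_refl.
pose p k := (B k k - d 0 k < 0) && (d 0 k <= d 0 j).
(* Without a deficit at or below the level of [j], the sum at level [d 0 j] would be positive. *)
have [i0 pi0] : exists i, p i.
  apply: contrapT => none; have := low (d 0 j); apply/negP; rewrite -ltNge.
  rewrite (bigD1 j) ?lexx//= ltr_pwDl// sumr_ge0// => k /andP[kj _].
  by rewrite leNgt; apply/negP => k0; apply: none; exists k; rewrite /p k0.
have [i /andP[ei dij] imax] := @arg_maxP _ _ _ i0 p (fun k => d 0 k) pi0.
set m := Num.min (B j j - d 0 j) (- (B i i - d 0 i)).
have m0 : 0 < m by rewrite lt_min ej oppr_gt0.
have mj : m <= B j j - d 0 j by rewrite ge_min lexx.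
have mi : m <= - (B i i - d 0 i) by rewrite ge_min lexx orbT.
have ji : j != i by apply: contraTneq ej => ->; rewrite -leNgt ltW.
have [|t mv] := @givens_exchange R n B j i m ji; first by apply/andP; split; lra.
have sumE (q : pred 'I_n) :
    \sum_(k | q k) ((givens j i t *m B *m (givens j i t)^T) k k - d 0 k) =
    \sum_(k | q k) (B k k - d 0 k) - m * ((q j)%:R - (q i)%:R).
  by rewrite !sumrB (sum_moved _ mv) addrAC.
have [|||B' BB' dB'] := IHN (givens j i t *m B *m (givens j i t)^T).
- rewrite -ltnS; apply: leq_trans cB; rewrite ltnS; apply: proper_card.
  have bE k : (givens j i t *m B *m (givens j i t)^T) k k =
      B k k - m * ((k == j)%:R - (k == i)%:R) by exact: mv.
  have ij : (i == j) = false by rewrite eq_sym (negPf ji).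
  apply/fintype.properP; split.
    apply/fintype.subsetP => k; rewrite !inE; apply: contra => /eqP kE.
    have kj : k != j by apply: contraTneq ej => <-; rewrite kE subrr ltxx.
    have ki : k != i by apply: contraTneq ei => <-; rewrite kE subrr ltxx.
    by rewrite bE (negPf kj) (negPf ki) subrr mulr0 subr0 kE.
  have [mE|mE] := leP (B j j - d 0 j) (- (B i i - d 0 i)).
    exists j; rewrite !inE; first by rewrite -subr_eq0 gt_eqF.
    rewrite negbK bE eqxx (negPf ji) subr0 mulr1 /m; apply/eqP.
    by rewrite (min_idPl mE) opprB addrC subrK.
  exists i; rewrite !inE; first by rewrite -subr_eq0 lt_eqF.
  rewrite negbK bE eqxx ij sub0r mulrN1 opprK /m; apply/eqP.
  by rewrite (min_idPr (ltW mE)) opprB addrC subrK.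
- move=> c; rewrite sumE.
  have [jc|cj] := leP (d 0 j) c; first by rewrite (le_trans dij jc) subrr mulr0 subr0.
  have [ic|ci] := leP (d 0 i) c; last by rewrite subrr mulr0 subr0.
  (* For [d 0 i <= c < d 0 j] the sum at level [c] grows by [m]. Between [c] and [d 0 j] there is no
     deficit, by the choice of [i], and the excess at [j] is at least [m]; so the new sum is at most
     the old one at level [d 0 j]. *)
  rewrite sub0r mulrN1 opprK; apply: le_trans (low (d 0 j)).
  rewrite [leRHS](bigID (fun k => d 0 k <= c))/=.
  rewrite [X in _ <= X + _](_ : _ = \sum_(k | d 0 k <= c) (B k k - d 0 k)); last first.
    apply: eq_bigl => k; apply: andb_idl => kc; exact: le_trans kc (ltW cj).
  rewrite lerD2l (bigD1 j) /=; last by rewrite lexx -ltNge.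
  rewrite (le_trans mj)// lerDl sumr_ge0// => k /andP[/andP[kj kc] _].
  rewrite leNgt; apply/negP => k0; move: kc; rewrite -ltNge => ck.
  have ki : d 0 k <= d 0 i by apply: (imax k); rewrite /p k0 kj.
  by have := lt_le_trans (le_lt_trans ic ck) ki; rewrite ltxx.
- by rewrite sumE tot subrr mulr0 subr0.
- exists B' => //; apply: osim_trans BB'.
  by exists (givens j i t) => //; exact: givens_orthogonal.
Qed.

Lemma diag_mx_diagv L : is_diag_mx L -> diag_mx (diagv L) = L.
Proof.
move=> /is_diag_mxP dL; apply/matrixP => i j; rewrite !mxE.
by have [->|ij] := eqVneq i j; rewrite ?mulr1n// mulr0n dL.
Qed.

(** Once the eigenvalues are laid out in the order of [d], the level sets of [d] carry the smallest
    ones, and majorization gives the hypotheses of [level_sums_horn]. *)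
Lemma horn d L : S_set d L -> exists2 B, osim L B & diagv B = d.
Proof.
move=> [dL Ld].
have rtot : total (fun i j => d 0 i <= d 0 j) by move=> i j; exact: le_total.
have rtr : transitive (fun i j => d 0 i <= d 0 j) by move=> j i k; exact: le_trans.
have [t [_ [_ _ _ lowt]]] := order_perm (fun i => diagv L 0 i) rtot rtr.
pose x : 'rV[R]_n := \row_i diagv L 0 (t i).
have [||B xB dB] := @level_sums_horn d (diag_mx x).
- move=> c; rewrite sumrB subr_le0.
  pose P := [set k | d 0 k <= c]%SET.
  have PE (F : 'I_n -> R) : \sum_(k | d 0 k <= c) F k = \sum_(k in P) F k.
    by apply: eq_bigl => k; rewrite inE.
  rewrite !PE (eq_bigr (fun i => diagv L 0 (t i))) => [|i _]; last first.
    by rewrite !mxE eqxx mulr1n.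
  apply: majorized_lower_set => // i j; rewrite !inE -ltNge => ic cj.
  by apply: lowt; rewrite -ltNge (le_lt_trans ic).
- rewrite sumrB -(majorized_sum Ld) (eq_bigr (fun i => diagv L 0 (t i))); last first.
    by move=> i _; rewrite !mxE eqxx mulr1n.
  by rewrite [X in _ - X](reindex_perm t) subrr.
exists B => //; apply: osim_trans xB.
rewrite -{1}(diag_mx_diagv dL); exact: osim_diag_perm.
Qed.

End Horn.

(** * Correcting single diagonal entries inside a class *)

Section Settling.
Context {R : realType} {n : nat}.
Implicit Types (A B M X P Q : 'M[R]_n) (i j k : 'I_n).

Lemma finite_radius (I : finType) (S : I -> R -> Prop) :
  (forall p, exists2 r : R, 0 < r & S p r) ->
  (forall p (r s : R), s <= r -> S p r -> S p s) ->
  exists2 r : R, 0 < r & forall p, S p r.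
Proof.
move=> ex mono.
suff [r r0 Sr] : exists2 r : R, 0 < r & forall p, p \in enum I -> S p r.
  by exists r => // p; apply: Sr; rewrite mem_enum.
elim: (enum I) => [|p s [r r0 Sr]]; first by exists 1.
have [r' r'0 Sr'] := ex p; exists (Num.min r r') => [|q]; first by rewrite lt_min r0.
rewrite inE => /orP[/eqP -> | qs]; first by apply: mono Sr'; rewrite ge_min lexx orbT.
by apply: mono (Sr _ qs); rewrite ge_min lexx.
Qed.

Definition isolated A i := [forall k, (k != i) ==> (A i k == 0)].

Lemma isolatedP A i : reflect (forall k, k != i -> A i k = 0) (isolated A i).
Proof.
apply: (iffP forallP) => H k; first by move=> ki; have := H k; rewrite ki => /eqP.
by apply/implyP => ki; rewrite H.
Qed.

Definition linked A : rel 'I_n := fun i j =>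
  (A i j != 0) || [&& isolated A i, isolated A j & A i i == A j j].

(* The classes are the connected components of the support graph of [A], except
   that isolated vertices with equal diagonal entries form a single class. *)
Definition cls A i := fingraph.root (linked A) i.

Lemma clsE A i j : A = A^T -> (cls A i == cls A j) = connect (linked A) i j.
Proof.
move=> sA; apply: root_connect; apply: sym_connect_sym => k l.
have kl : A k l = A l k by rewrite [in LHS]sA mxE.
by rewrite /linked kl andbCA (eq_sym (A k k)).
Qed.

Lemma cls_block A : A = A^T -> block_mx_on (cls A) A.
Proof.
move=> sA i j; rewrite clsE//; apply: contraNeq => nz.
by apply: connect1; rewrite /linked nz.
Qed.

Lemma cls_isolated A i j : A = A^T -> isolated A i -> isolated A j ->
  A i i = A j j -> cls A i = cls A j.
Proof.
move=> sA ii ij e; apply/eqP; rewrite clsE//; apply: connect1.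
by rewrite /linked ii ij e eqxx orbT.
Qed.

(** Apart from loops, an edge of the support graph never touches an isolated vertex, so the two
    kinds of links do not mix along a path. *)
Lemma cls_connect A i j : A = A^T -> cls A i = cls A j ->
  connect (fun i j => A i j != 0) i j \/
  [/\ isolated A i, isolated A j & A i i = A j j].
Proof.
move=> sA /eqP; rewrite clsE// => /connectP[p].
have iso_conn k l : isolated A k -> connect (fun i j => A i j != 0) k l -> k = l.
  move=> /isolatedP ik /connectP[q]; elim: q => [|x q IHq] /=; first by move=> _ ->.
  move=> /andP[kx xq] e; have [xk|xk] := eqVneq x k; first by apply: IHq; rewrite -?xk.
  by rewrite ik ?eqxx in kx.
elim: p i => [|x p IHp] i /=; first by move=> _ ->; left; exact: connect0.
move=> /andP[ix xp] jl; have := IHp x xp jl.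
move: ix; rewrite /linked => /orP[nz|/and3P[ii ix /eqP e]].
  case=> [xj|[ix ij e]].
    by left; apply: connect_trans xj; exact: connect1.
  have [xi|xi] := eqVneq i x; first by right; rewrite xi.
  move/isolatedP: ix => /(_ i xi); rewrite [in LHS]sA mxE => nz0.
  by rewrite nz0 eqxx in nz.
case=> [xj|[_ ij e']]; first by right; rewrite -(iso_conn _ _ ix xj).
by right; rewrite e.
Qed.

(** In the rotated plane [A] is a scalar, split off from the rest, so it commutes with the
    rotation. *)
Lemma isolated_givens A i j t : A = A^T -> i != j -> isolated A i -> isolated A j ->
  A i i = A j j -> givens i j t *m A *m (givens i j t)^T = A.
Proof.
move=> sA ij /isolatedP Ai /isolatedP Aj Aij.
have cA k l : A k l = A l k by rewrite [in LHS]sA mxE.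
have ji : j != i by rewrite eq_sym.
apply/matrixP => k l; rewrite givens_conjE// !givens_mulE// (Ai j)// (Aj i)// -Aij.
have cs := congr1 (fun z => z * A i i) (cos2Dsin2 t).
have [ek|ki] := eqVneq k i; have [el|li] := eqVneq l i;
  have [ek'|kj] := eqVneq k j; have [el'|lj] := eqVneq l j;
  rewrite ?ek ?el ?ek' ?el' ?eqxx ?(negPf ij) ?(negPf ji) ?(Ai l) ?(Aj l) ?(Ai j) ?(Aj i)
   ?(cA k i) ?(cA k j) ?(Ai k) ?(Aj k) -?Aij //=; try lra.
all: by rewrite ?ek' ?el' ?ek ?el ?eqxx in ij ji ki kj li lj *.
Qed.

(** Weaker than a transfer of entries: the amount may exceed neither the excess at [i] nor the
    deficit at [j]. Isolated vertices can offer no more than this. *)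
Definition settles A i j := forall e : R, 0 < e -> exists2 r : R, 0 < r &
  forall B m, frob_norm (B - A) < r -> 0 <= m < r ->
    m <= B i i - A i i -> m <= A j j - B j j ->
    exists B', [/\ osim B B', frob_norm (B' - A) < e &
      moved (fun k => B k k) i j m (fun k => B' k k)].

(* Between isolated vertices with equal entries of [A] no small rotation moves
   enough mass, but there [A] is invariant under all rotations. *)
Lemma cls_settles A i j : A = A^T -> i != j -> cls A i = cls A j -> settles A i j.
Proof.
move=> sA ij /(cls_connect sA)[conn e e0|[ii jj Aij] e e0].
  have [||r r0 tr] := @transfers_connect R n id A _ i j _ conn e => //.
    move=> k l nz; have [->|kl] := eqVneq k l; first exact: transfers_refl.
    apply: givens_transfers => //; apply: givens_val_lt_offdiag.
    have -> : A l k = A k l by rewrite [in LHS]sA mxE.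
    by rewrite -mulr2n mulrn_eq0.
  exists r => // B m Br mr _ _; have [B' [BB' B'e B'd]] := tr B m Br mr.
  by exists B'; split => // k; have := B'd k; rewrite !csum_id.
exists e => // B m Be /andP[m0 _] mi mj.
have [|t mv] := @givens_exchange R n B i j m ij; first by apply/andP; split; lra.
exists (givens i j t *m B *m (givens i j t)^T); split => //.
  by exists (givens i j t) => //; exact: givens_orthogonal.
rewrite -[X in _ - X](isolated_givens t sA ij ii jj Aij) conj_mxB frob_conj//.
exact: givens_orthogonal.
Qed.

(** Equal class sums pair every excess with a deficit in the same class. Moving the smaller of the
    two settles an entry, so at most [n] moves are made; their radii are chosen from the last move
    backwards. *)
Lemma cls_settle_diag A : A = A^T -> forall e : R, 0 < e -> exists2 r : R, 0 < r &
  forall B, frob_norm (B - A) < r ->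
    (forall k, csum (cls A) (fun l => B l l) k = csum (cls A) (fun l => A l l) k) ->
    exists B', [/\ osim B B', frob_norm (B' - A) < e & diagv B' = diagv A].
Proof.
move=> sA e e0.
suff [r r0 rP] : exists2 r : R, 0 < r & forall B,
    (#|[set k | B k k != A k k]%SET| < n.+1)%N -> frob_norm (B - A) < r ->
    (forall k, csum (cls A) (fun l => B l l) k = csum (cls A) (fun l => A l l) k) ->
    exists B', [/\ osim B B', frob_norm (B' - A) < e & diagv B' = diagv A].
  exists r => // B; apply: rP; rewrite ltnS -[X in (_ <= X)%N]card_ord; exact: max_card.
elim: n.+1 => [|N [r r0 IHN]]; first by exists 1.
have [s s0 sP] : exists2 s : R, 0 < s & forall p : 'I_n * 'I_n,
    p.1 != p.2 -> cls A p.1 = cls A p.2 ->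
    forall B m, frob_norm (B - A) < s -> 0 <= m < s ->
    m <= B p.1 p.1 - A p.1 p.1 -> m <= A p.2 p.2 - B p.2 p.2 ->
    exists B', [/\ osim B B', frob_norm (B' - A) < r &
      moved (fun k => B k k) p.1 p.2 m (fun k => B' k k)].
  apply: (finite_radius (S := fun p s => _)) => [[i j]/=|p s s' ss H ne ecl B m Bs /andP[m0 ms]].
    have [->|ij] := eqVneq i j; first by exists 1.
    have [cij|cij] := eqVneq (cls A i) (cls A j); last by exists 1 => // _ /eqP; rewrite (negPf cij).
    by have [s s0 H] := cls_settles sA ij cij r0; exists s.
  by apply: H => //; [exact: lt_le_trans ss | rewrite m0 (lt_le_trans ms)].
exists (Num.min e s) => [|B cB]; first by rewrite lt_min e0.
rewrite lt_min => /andP[Be Bs] BA.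
have [eBA|] := pselect (diagv B = diagv A); first by exists B; split => //; exact: osim_refl.
move=> neq.
have [k0 k0P] : exists k, B k k != A k k.
  apply: contrapT => none; apply: neq; apply/rowP => k; rewrite !mxE.
  by apply: contrapT => /eqP Bk; apply: none; exists k.
have sum0 : \sum_(l | cls A l == cls A k0) (B l l - A l l) = 0.
  by rewrite sumrB; apply/eqP; rewrite subr_eq0; apply/eqP; exact: BA.
have [i /andP[/eqP ci ei]] : exists i, (cls A i == cls A k0) && (0 < B i i - A i i).
  apply: contrapT => none.
  have : - (B k0 k0 - A k0 k0) = 0.
    apply: (psumr_eq0P (P := fun l => cls A l == cls A k0)
      (F := fun l => - (B l l - A l l))) => //; last by rewrite sumrN sum0 oppr0.
    move=> l cl; rewrite oppr_ge0 leNgt; apply/negP => l0.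
    by apply: none; exists l; rewrite cl.
  by move/eqP; rewrite oppr_eq0 subr_eq0 (negPf k0P).
have [j /andP[/eqP cj ej]] : exists j, (cls A j == cls A k0) && (B j j - A j j < 0).
  apply: contrapT => none.
  have : B k0 k0 - A k0 k0 = 0.
    apply: (psumr_eq0P (P := fun l => cls A l == cls A k0)
      (F := fun l => B l l - A l l)) => //.
    move=> l cl; rewrite leNgt; apply/negP => l0.
    by apply: none; exists l; rewrite cl.
  by move/eqP; rewrite subr_eq0 (negPf k0P).
have ij : i != j by apply: contraTneq ei => ->; rewrite -leNgt ltW.
have cij : cls A i = cls A j by rewrite ci.
set m := Num.min (B i i - A i i) (A j j - B j j).
have m0 : 0 < m by rewrite lt_min ei; lra.
have mi : m <= B i i - A i i by rewrite ge_min lexx.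
have mj : m <= A j j - B j j by rewrite ge_min lexx orbT.
have [|B1 [BB1 B1r mv]] := sP (i, j) ij cij B m Bs _ mi mj.
  rewrite ltW//=; apply: le_lt_trans Bs; apply: le_trans mi _.
  by apply: le_trans (ler_norm_frob _ i i); rewrite !mxE ler_norm.
have [||B' [BB' B'e B'd]] := IHN B1 _ B1r.
- rewrite -ltnS; apply: leq_trans cB; rewrite ltnS; apply: proper_card.
  have bE k : B1 k k = B k k - m * ((k == i)%:R - (k == j)%:R) by exact: mv.
  have ji : (j == i) = false by rewrite eq_sym (negPf ij).
  apply/fintype.properP; split.
    apply/fintype.subsetP => k; rewrite !inE; apply: contra => /eqP kE.
    have ki : k != i by apply: contraTneq ei => <-; rewrite kE subrr ltxx.
    have kj : k != j by apply: contraTneq ej => <-; rewrite kE subrr ltxx.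
    by rewrite bE (negPf kj) (negPf ki) subrr mulr0 subr0 kE.
  have [mE|mE] := leP (B i i - A i i) (A j j - B j j).
    exists i; rewrite !inE; first by rewrite -subr_eq0 gt_eqF.
    rewrite negbK bE eqxx (negPf ij) subr0 mulr1 /m; apply/eqP.
    by rewrite (min_idPl mE) opprB addrC subrK.
  exists j; rewrite !inE; first by rewrite -subr_eq0 lt_eqF.
  rewrite negbK bE eqxx ji sub0r mulrN1 opprK /m; apply/eqP.
  by rewrite (min_idPr (ltW mE)) addrC subrK.
- by move=> k; rewrite (moved_csum _ _ mv) cij subrr mulr0 subr0.
by exists B'; split => //; exact: osim_trans BB'.
Qed.

End Settling.

(** * Routing mass along a chain *)

Section Flow.
Context {R : realType} {n : nat}.
Context (T : rel 'I_n).
Implicit Types (B M : 'M[R]_n) (v w : 'I_n -> R) (i j k x y : 'I_n) (s : seq 'I_n).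

(* Along [s], every partial sum of [v] (started at [a]) that is positive occurs
   at a place where [T] allows mass to be passed on to the next element. *)
Fixpoint passable (v : 'I_n -> R) (a : R) s : Prop :=
  if s is x :: s' then
    (if s' is y :: _ then T x y \/ a + v x <= 0 else True) /\ passable v (a + v x) s'
  else True.

Lemma eq_passable v w a s : {in s, v =1 w} -> passable v a s -> passable w a s.
Proof.
elim: s a => //= x s IHs a vw; rewrite (vw x) ?mem_head// => -[H1 H2]; split=> //.
by apply: IHs H2 => y ys; apply: vw; rewrite inE ys orbT.
Qed.

Lemma passable_prefix v a s :
  (forall p x y q, s = p ++ x :: y :: q ->
     T x y \/ a + \sum_(i <- rcons p x) v i <= 0) -> passable v a s.
Proof.
elim: s a => //= x s IHs a H; split.
  case: s H {IHs} => // y s H; have := H [::] x y s erefl.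
  by rewrite big_seq1.
apply: IHs => p y z q sE; have := H (x :: p) y z q.
by rewrite sE /= big_cons addrA; apply.
Qed.

(** Each element hands its balance over to the next one: a negative balance is filled from there,
    which the sorting of [s] allows, and a positive one is sent on, which [passable] allows. The
    total being zero, nothing is left at the end. *)
Lemma flow cl M s : (forall i j, T i j -> transfers cl M i j) ->
  uniq s -> sorted (fun x y => T y x) s ->
  forall e : R, 0 < e -> exists2 r : R, 0 < r &
  forall B v w, frob_norm (B - M) < r -> \sum_k `|v k| < r -> \sum_k v k = 0 ->
    (forall k, k \notin s -> v k = 0) -> passable v 0 s ->
    (forall k, csum cl (fun l => B l l) k = csum cl w k + csum cl v k) ->
    exists B', [/\ osim B B', frob_norm (B' - M) < e &
      forall k, csum cl (fun l => B' l l) k = csum cl w k].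
Proof.
move=> TM; elim: s => [|x [|y s] IHs].
- move=> _ _ e e0; exists e => // B v w Be _ _ v0 _ Bw; exists B; split => //.
    exact: osim_refl.
  by move=> k; rewrite Bw [X in _ + X]big1 ?addr0// => l _; exact: v0.
- move=> _ _ e e0; exists e => // B v w Be _ sv v0 _ Bw; exists B; split => //.
    exact: osim_refl.
  have vk k : v k = 0.
    have [->|kx] := eqVneq k x; last by apply: v0; rewrite inE.
    by rewrite -[RHS]sv (bigD1 x)//= big1 ?addr0// => l lx; apply: v0; rewrite inE.
  by move=> k; rewrite Bw [X in _ + X]big1 ?addr0.
move=> /andP[xs us]; rewrite [sorted _ _]/= => /andP[Tyx ys] e e0.
have [r r0 rP] := IHs us ys _ e0.
have xy : x != y by apply: contraNneq xs => ->; exact: mem_head.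
have tryx := TM _ _ Tyx.
have [r1 r10 r1P] := tryx _ r0.
have [r2 r20 r2P] : exists2 r2 : R, 0 < r2 & T x y ->
    forall B m, frob_norm (B - M) < r2 -> 0 <= m < r2 ->
    exists B', [/\ osim B B', frob_norm (B' - M) < r &
      forall k, csum cl (fun l => B' l l) k = csum cl (fun l => B l l) k
        - m * ((cl k == cl x)%:R - (cl k == cl y)%:R)].
  have [/TM tr|_] := boolP (T x y); last by exists 1.
  by have [r2 r20 r2P] := tr _ r0; exists r2.
(* The new balances sum in absolute value to at most the old sum plus twice [v x] in absolute value,
   hence to at most three times the old sum. *)
exists (Num.min (r / 3) (Num.min r1 r2)) => [|B v w].
  by rewrite !lt_min r10 r20 divr_gt0.
rewrite !lt_min => /and3P[_ Br1 Br2] /and3P[vr vr1 vr2] sv v0 [pas pass] Bw.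
have vx : `|v x| <= \sum_k `|v k|.
  by rewrite (bigD1 x)//= lerDl sumr_ge0.
pose v' k := v k - v x * ((k == x)%:R - (k == y)%:R).
have [B1 [BB1 B1r B1d]] : exists B1, [/\ osim B B1, frob_norm (B1 - M) < r &
    forall k, csum cl (fun l => B1 l l) k = csum cl (fun l => B l l) k
        - v x * ((cl k == cl x)%:R - (cl k == cl y)%:R)].
  have [vx0|vx0] := leP (v x) 0.
    have [|B1 [BB1 B1r B1d]] := r1P B (- v x) Br1.
      by rewrite oppr_ge0 vx0 (le_lt_trans _ vr1)// -(ler0_norm vx0).
    by exists B1; split => // k; rewrite B1d; ring.
  have Txy : T x y by case: pas => //; rewrite add0r leNgt vx0.
  by apply: r2P => //; rewrite ltW//= (le_lt_trans _ vr2)// -(gtr0_norm vx0).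
have mv : moved v x y (v x) v' by [].
have [|||||B' [B1B' B'e B'd]] := rP B1 v' w B1r.
- apply: le_lt_trans (_ : \sum_k (`|v k| + `|v x| * ((k == x)%:R + (k == y)%:R)) < r).
    apply: ler_sum => k _; apply: le_trans (ler_normB _ _) _; rewrite lerD2l normrM.
    by rewrite ler_wpM2l// (le_trans (ler_normB _ _))// !ger0_norm.
  rewrite big_split/= -mulr_sumr big_split/= !sum_indic.
  by rewrite -[true%:R + _]/(2%:R); lra.
- by rewrite (sum_moved xpredT mv) sv subrr mulr0 subr0.
- move=> k; rewrite inE negb_or => /andP[ky ks]; rewrite /v' (negPf ky) subr0.
  have [->|kx] := eqVneq k x; first by rewrite mulr1 subrr.
  by rewrite mulr0 subr0 v0// !inE !negb_or kx ky.
- move: pass; rewrite /= add0r => -[p1 p2].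
  have v'y : v' y = v x + v y by rewrite /v' eqxx eq_sym (negPf xy) /=; ring.
  rewrite add0r v'y; split => //; apply: eq_passable p2 => k ks.
  have kx : k != x by apply: contraNneq xs => <-; rewrite inE ks orbT.
  have ky : k != y by move: us => /andP[+ _]; apply: contraNneq => <-.
  by rewrite /v' (negPf kx) (negPf ky) subrr mulr0 subr0.
- by move=> k; rewrite B1d Bw (moved_csum _ _ mv) addrA.
by exists B'; split => //; exact: osim_trans B1B'.
Qed.

End Flow.

(** * Lifting a nearby spectrum to a nearby matrix *)

Section LocalLift.
Context {R : realType} {n : nat}.
Implicit Types (A B D L M X P Q : 'M[R]_n) (i j k l : 'I_n) (S : {set 'I_n}).

(** The projection onto a union of classes commutes with [P], so the partial trace over it is
    invariant. *)
Lemma sum_diag_block_conj cl P X (p : pred 'I_n) :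
  orthogonal_mx P -> block_mx_on cl P ->
  (forall i j, cl i = cl j -> p i -> p j) ->
  \sum_(i | p i) (P^T *m X *m P) i i = \sum_(i | p i) X i i.
Proof.
move=> oP bP pcl.
have PE a b : \sum_(i | p i) P a i * P b i = (p a && (a == b))%:R.
  have [pa|pa] /= := boolP (p a).
    have <- : (P *m P^T) a b = (a == b)%:R by rewrite oP mxE.
    rewrite mxE [RHS](bigID p)/= [X in _ + X]big1 ?addr0 => [|i pi].
      by apply: eq_bigr => i _; rewrite mxE.
    rewrite bP ?mul0r//; apply: contraNneq pi => ai; exact: pcl ai pa.
  rewrite big1// => i pi; rewrite bP ?mul0r//.
  by apply: contraNneq pa => /esym ia; exact: pcl ia pi.
transitivity (\sum_a \sum_b X a b * \sum_(i | p i) P a i * P b i).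
  rewrite (eq_bigr (fun i => \sum_a \sum_b X a b * (P a i * P b i))) => [|i _].
    rewrite exchange_big; apply: eq_bigr => a _; rewrite exchange_big.
    by apply: eq_bigr => b _; rewrite mulr_sumr.
  rewrite mxE exchange_big; apply: eq_bigr => b _; rewrite mxE mulr_suml.
  by apply: eq_bigr => a _; rewrite mxE; ring.
rewrite [RHS]big_mkcond; apply: eq_bigr => a _.
rewrite (bigD1 a)//= [X in _ + X]big1 ?addr0 => [|b ba].
  by rewrite PE eqxx andbT; case: (p a); rewrite ?mulr1 ?mulr0.
by rewrite PE eq_sym (negPf ba) andbF mulr0.
Qed.

Lemma isolated_of_scalar A P i (mu : 'rV[R]_n) :
  orthogonal_mx P -> block_mx_on (cls A) P -> P *m A *m P^T = diag_mx mu ->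
  (forall k, cls A k = cls A i -> mu 0 k = mu 0 i) ->
  isolated A i /\ A i i = mu 0 i.
Proof.
move=> oP bP PA mui.
have AE l : A i l = mu 0 i * (i == l)%:R.
  rewrite -(conj_mxK A oP) PA -mulmxA mxE.
  have <- : (P^T *m P) i l = (i == l)%:R by rewrite orthogonal_mxC// mxE.
  rewrite mxE mulr_sumr; apply: eq_bigr => k _.
  rewrite mul_diag_mx !mxE; have [e|ne] := eqVneq (cls A k) (cls A i).
    by rewrite mui//; ring.
  by rewrite bP//; ring.
by split; [apply/isolatedP => k ki; rewrite AE eq_sym (negPf ki) mulr0 | rewrite AE eqxx mulr1].
Qed.

(** Steps inside a class are free, as only class sums are tracked; between classes mass goes from a
    larger eigenvalue to a smaller one. *)
Definition passes (cl : 'I_n -> 'I_n) (mu : 'rV[R]_n) : rel 'I_n :=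
  connect (fun i j => (cl i == cl j) || (mu 0 j < mu 0 i)).

Lemma passes_transfers cl mu i j : passes cl mu i j -> transfers cl (diag_mx mu) i j.
Proof.
apply: transfers_connect => k l /orP[/eqP|lk]; first exact: transfers_refl.
have kl : k != l by apply: contraTneq lk => ->; rewrite ltxx.
by apply: givens_transfers => //; apply: givens_val_lt_diag; rewrite !mxE !eqxx !mulr1n.
Qed.

(** Only equal eigenvalues need care. If one of the two classes has a further eigenvalue, it serves
    as a detour; otherwise both vertices are isolated with the same entry, and this is why such
    vertices are put into one class. *)
Lemma passes_total A P (mu : 'rV[R]_n) : A = A^T ->
  orthogonal_mx P -> block_mx_on (cls A) P -> P *m A *m P^T = diag_mx mu ->
  total (passes (cls A) mu).
Proof.
move=> sA oP bP PA i j; apply/orP; rewrite /passes.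
set T := (X in connect X).
have T1 k l : mu 0 l < mu 0 k -> connect T k l.
  by move=> lk; apply: connect1; rewrite /T lk orbT.
have Tc k l : cls A k = cls A l -> connect T k l.
  by move=> kl; apply: connect1; rewrite /T kl eqxx.
have [/T1|/T1|mij] := ltgtP (mu 0 i) (mu 0 j); [by right|by left|].
have [si|/existsNP[k /not_implyP[ki mki]]] :=
    pselect (forall k, cls A k = cls A i -> mu 0 k = mu 0 i); last first.
  have [lt|lt|//] := ltgtP (mu 0 k) (mu 0 i).
    by right; apply: connect_trans (Tc k i ki); apply: T1; rewrite -mij.
  by left; apply: connect_trans (Tc i k (esym ki)) _; apply: T1; rewrite -mij.
have [sj|/existsNP[k /not_implyP[kj mkj]]] :=
    pselect (forall k, cls A k = cls A j -> mu 0 k = mu 0 j); last first.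
  have [lt|lt|//] := ltgtP (mu 0 k) (mu 0 j).
    by left; apply: connect_trans (Tc k j kj); apply: T1; rewrite mij.
  by right; apply: connect_trans (Tc j k (esym kj)) _; apply: T1; rewrite mij.
have [ii ei] := isolated_of_scalar oP bP PA si.
have [ij ej] := isolated_of_scalar oP bP PA sj.
by left; apply: Tc; apply: cls_isolated => //; rewrite ei ej.
Qed.

Lemma perm_eq_map_perm (s : seq 'I_n) (t : 'S_n) :
  perm_eq s (enum 'I_n) -> perm_eq [seq t i | i <- s] (enum 'I_n).
Proof.
move=> sE; apply: uniq_perm.
- by rewrite (map_inj_uniq perm_inj) (perm_uniq sE) enum_uniq.
- exact: enum_uniq.
move=> i; rewrite mem_enum -[i](permKV t) map_f//.
by rewrite (perm_mem sE) mem_enum.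
Qed.

(** A perturbation below half the smallest gap between distinct values cannot reverse a strict
    inequality, so laying out the perturbed values in order also lays out the original ones in
    order. *)
Lemma sorted_rearrangement_close (x y : 'rV[R]_n) (u : 'S_n) :
  (forall i, y 0 i = x 0 (u i)) ->
  exists2 g : R, 0 < g & forall (x' : 'rV[R]_n) (t : 'S_n) s,
    (forall i, `|x' 0 i - x 0 i| < g) -> perm_eq s (enum 'I_n) ->
    sorted <=%R [seq y 0 i | i <- s] -> sorted <=%R [seq x' 0 (t i) | i <- s] ->
    forall i, x 0 (t i) = y 0 i.
Proof.
move=> yx.
have [g g0 gap] : exists2 g : R, 0 < g & forall p : 'I_n * 'I_n,
    x 0 p.1 < x 0 p.2 -> g <= x 0 p.2 - x 0 p.1.
  apply: finite_radius => [[i j]/=|p r s sr H /H]; last exact: le_trans.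
  have [lt|_] := ltP (x 0 i) (x 0 j); last by exists 1.
  by exists (x 0 j - x 0 i); rewrite ?subr_gt0.
exists (g / 2) => [|x' t s close sE ys xs]; first by rewrite divr_gt0.
have /eq_in_map e : [seq x 0 (t i) | i <- s] = [seq y 0 i | i <- s].
  apply: le_sorted_eq => //.
    move: xs; rewrite !sorted_map; apply: sub_sorted => i j /= ij.
    rewrite leNgt; apply/negP => ji; have := gap (t j, t i) ji.
    have := close (t i); have := close (t j); rewrite /= !ltr_norml.
    by move=> /andP[? ?] /andP[? ?] ?; lra.
  rewrite (eq_map yx) (map_comp (x 0) t) (map_comp (x 0) u) perm_map//.
  by rewrite (perm_trans (perm_eq_map_perm t sE))// perm_sym perm_eq_map_perm.
by move=> i; apply: e; rewrite (perm_mem sE) mem_enum.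
Qed.

Lemma conj_flip P A B : orthogonal_mx P -> P *m A *m P^T = B -> A = P^T *m B *m P.
Proof. by move=> oP <-; rewrite conj_mxK. Qed.

Lemma local_lift d A L : A = A^T -> diagv A = d -> is_diag_mx L -> osim L A ->
  forall e : R, 0 < e -> exists2 r : R, 0 < r &
  forall L', S_set d L' -> frob_norm (L' - L) < r ->
    exists A', [/\ osim L' A', diagv A' = d & frob_norm (A' - A) < e].
Proof.
move=> sA dA dL LA e e0.
have [P [oP bP dP]] := block_spectral sA (cls_block sA).
have [mu PA] : exists mu, P *m A *m P^T = diag_mx mu.
  by exists (diagv (P *m A *m P^T)); rewrite diag_mx_diagv.
have AP : A = P^T *m diag_mx mu *m P by apply: conj_flip.
pose T := passes (cls A) mu.
have Ttot : total T := passes_total sA oP bP PA.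
have Ttr : transitive T by move=> j i k; exact: connect_trans.
have Tmu i j : mu 0 j < mu 0 i -> T i j by move=> ji; apply: connect1; rewrite ji orbT.
have Tcl i j : cls A i = cls A j -> T i j by move=> ij; apply: connect1; rewrite ij eqxx.
(* Ties between eigenvalues are broken by [T], so that sets which mass cannot leave come first and
   receive the smallest eigenvalues of [L']. *)
pose r i j := (mu 0 i < mu 0 j) || (mu 0 i == mu 0 j) && T j i.
have rtot : total r.
  move=> i j; rewrite /r; have [|//|_] := ltgtP (mu 0 i) (mu 0 j); rewrite ?orbT//=.
have rtr : transitive r.
  move=> j i k; rewrite /r => /orP[ij|/andP[/eqP ij ji]] /orP[jk|/andP[/eqP jk kj]].
  - by rewrite (lt_trans ij jk).
  - by rewrite -jk ij.
  - by rewrite ij jk.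
  - by rewrite ij jk eqxx (Ttr _ _ _ kj ji) orbT.
have [u muu] : exists u : 'S_n, forall i, mu 0 i = diagv L 0 (u i).
  apply: osim_diag_perm_eq => z; rewrite (diag_mx_diagv dL) (osim_char_poly LA) -PA.
  by congr mup; apply: osim_char_poly; exists P.
have [g g0 gP] := sorted_rearrangement_close muu.
have [r1 r10 settle] := cls_settle_diag sA e0.
pose s := sort (fun x y => T y x) (enum 'I_n).
have sE : perm_eq s (enum 'I_n) by rewrite perm_sort.
have us : uniq s by rewrite (perm_uniq sE) enum_uniq.
have ss : sorted (fun x y => T y x) s by apply: sort_sorted => i j; exact: Ttot.
have [r2 r20 flowP] := flow (fun i j => @passes_transfers (cls A) mu i j) us ss r10.
(* Positive also for [n = 0]; one factor [N] bounds a norm by its entries, the other a sum of [n]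
   terms. *)
pose N : R := n%:R + 1.
have N0 : 0 < N by rewrite ltr_wpDl.
exists (Num.min g (r2 / N ^+ 2)) => [|L' [dL' L'd]].
  by rewrite lt_min g0 divr_gt0// exprn_gt0.
set h := frob_norm (L' - L); rewrite lt_min => /andP[hg hr2].
have h0 : 0 <= h by exact: frob_ge0.
have [t [s0 [s0E s0r s0x low]]] := order_perm (diagv L' 0) rtot rtr.
have xmu : forall i, diagv L 0 (t i) = mu 0 i.
  apply: (gP (diagv L') t s0) => //.
    move=> i; apply: le_lt_trans hg; apply: le_trans (ler_norm_frob _ i i).
    by rewrite !mxE.
  rewrite sorted_map; apply: sub_sorted s0r => i j /orP[/ltW//|/andP[/eqP e1 _]].
  by rewrite /relpre/= e1.
pose f : 'rV[R]_n := \row_i diagv L' 0 (t i).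
(* The eigenvectors of [A] with the eigenvalues of [L']. *)
pose B0 := P^T *m diag_mx f *m P.
have oPT := orthogonal_mxT oP.
have L'f : osim L' (diag_mx f).
  by rewrite -{1}(diag_mx_diagv dL'); exact: osim_diag_perm.
have fmu : frob_norm (diag_mx f - diag_mx mu) <= N * h.
  apply: (@le_trans _ _ (n%:R * h)); last by rewrite ler_wpM2r// lerDl.
  apply: frob_le_entries => // i j; rewrite !mxE.
  have [->|ij] := eqVneq i j; last by rewrite !mulr0n subr0 normr0.
  rewrite !mulr1n -xmu mxE; apply: le_trans (ler_norm_frob _ (t j) (t j)).
  by rewrite !mxE.
have B0A : frob_norm (B0 - A) <= N * h.
  by rewrite AP /B0 -{2 4}(trmxK P) conj_mxB frob_conj.
pose v k := B0 k k - A k k.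
have dE k : d 0 k = A k k by rewrite -dA mxE.
have Nr : N * h < r2.
  have : N ^+ 2 * h < r2 by rewrite mulrC -ltr_pdivlMr// exprn_gt0.
  apply: le_lt_trans; rewrite ler_wpM2r// expr2 ler_pMl// lerDr//.
have sv : \sum_k `|v k| < r2.
  have : N ^+ 2 * h < r2 by rewrite mulrC -ltr_pdivlMr// exprn_gt0.
  apply: le_lt_trans; apply: (@le_trans _ _ (\sum_(k < n) N * h)).
    apply: ler_sum => k _; apply: le_trans B0A.
    have -> : v k = (B0 - A) k k by rewrite /v [RHS]mxE [X in _ = _ + X]mxE.
    exact: ler_norm_frob.
  rewrite sumr_const card_ord -mulr_natl mulrA ler_wpM2r// expr2 ler_wpM2r ?lerDl//.
  exact: ltW.
have sumB0 (p : pred 'I_n) : (forall i j, cls A i = cls A j -> p i -> p j) ->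
    \sum_(i | p i) B0 i i = \sum_(i | p i) f 0 i.
  move=> pcl; rewrite (sum_diag_block_conj _ oP bP pcl); apply: eq_bigr => i _.
  by rewrite mxE eqxx mulr1n.
(* The flow is run in the eigenbasis; conjugation by [P] does not change class sums. *)
have [||||||D1 [D1sim D1r D1d]] := flowP (diag_mx f) v (fun k => A k k).
- exact: le_lt_trans Nr.
- exact: sv.
- rewrite sumrB (sumB0 xpredT)// -(eq_bigr _ (fun k _ => dE k)).
  rewrite -(majorized_sum L'd) [X in _ - X](reindex_perm t) -sumrB big1// => i _.
  by rewrite !mxE subrr.
- by move=> k; rewrite (perm_mem sE) mem_enum.
- apply: passable_prefix => p x y q sxy; rewrite add0r.
  have [Txy|nT] := boolP (T x y); [by left | right].
  (* Where the chain is blocked, the prefix is closed under [T], hence a lower set for the new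
     eigenvalues, and majorization bounds its balance by 0. *)
  pose S := [set i in rcons p x]%SET.
  have Trefl i : T i i by exact: connect0.
  have := ss; rewrite sorted_pairwise; last by move=> j i k ij jk; exact: Ttr jk ij.
  rewrite sxy -cat_rcons pairwise_cat => /and3P[_ + /= /andP[/allP qy _]].
  rewrite pairwise_rcons => /andP[/allP px _].
  have Sin i : i \in rcons p x -> T x i.
    by rewrite mem_rcons inE => /orP[/eqP ->|/px].
  have Sout i : i \notin rcons p x -> T i y.
    have : i \in s by rewrite (perm_mem sE) mem_enum.
    rewrite sxy -cat_rcons mem_cat => /orP[->//|].
    by rewrite inE => /orP[/eqP ->|/qy].
  have Sclosed i j : T i j -> i \in S -> j \in S.
    rewrite !inE => ij iS; apply: contraR nT => jS.
    exact: Ttr (Sin i iS) (Ttr _ _ _ ij (Sout j jS)).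
  have -> : \sum_(i <- rcons p x) v i = \sum_(i in S) v i.
    rewrite big_uniq; first by apply: eq_bigl => i; rewrite inE.
    by move: us; rewrite sxy -cat_rcons cat_uniq => /and3P[].
  rewrite sumrB (sumB0 (mem S)) => [|i j ij]; last by apply: Sclosed; exact: Tcl.
  rewrite subr_le0.
  rewrite (eq_bigr (fun i => diagv L' 0 (t i))) => [|i _]; last by rewrite mxE.
  rewrite [leRHS](eq_bigr (fun i => d 0 i)) => [|i _]; last by rewrite dE.
  apply: majorized_lower_set => // i j iS jS; apply: low.
  have nij : ~~ T i j by apply: contra jS => ij; exact: Sclosed iS.
  rewrite /r negb_or -leNgt leNgt; apply/andP; split.
    by apply: contra nij; exact: Tmu.
  by rewrite negb_and nij orbT.
- move=> k; rewrite -big_split/= -[LHS](sum_diag_block_conj (diag_mx f) oP bP).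
    by apply: eq_bigr => i _; rewrite /v addrC subrK.
  by move=> i j ->.
have [||A' [BA' A'e A'd]] := settle (P^T *m D1 *m P).
- rewrite AP -{2 4}(trmxK P) conj_mxB frob_conj//.
- move=> k; rewrite -D1d; by apply: (sum_diag_block_conj D1 oP bP) => i j ->.
exists A'; split => //; last by rewrite A'd.
apply: osim_trans L'f _; apply: osim_trans D1sim _; apply: osim_trans BA'.
by exists P^T => //; rewrite trmxK.
Qed.

End LocalLift.

(** * Fibres over nearby spectra and continuity *)

Section Continuity.
Context {R : realType} {n : nat}.
Implicit Types (A B L X Y Q : 'M[R]_n) (d : 'rV[R]_n).

Lemma xget_horn_mx d L : S_set d L -> horn_mx d L (xget 1%:M (horn_mx d L)).
Proof.
move=> SL; have [B [Q oQ BQ] dB] := horn SL.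
by apply: xgetPex; exists Q; split => //; rewrite -BQ.
Qed.

(** Diagonalizing [X] turns equal multiplicities into orthogonal similarity; the chosen [Q]
    disappears from the description. *)
Lemma schur_hornE d L X : S_set d L ->
  schur_horn d L X <-> osim L X /\ diagv X = d.
Proof.
move=> SL; have dL := SL.1.
rewrite /schur_horn; have := xget_horn_mx SL.
move: (xget _ _) => P [oP dP].
have LA : osim L (P *m L *m P^T) by exists P.
split=> [[[dX sX] AX]|[LX dX]]; last first.
  split; first by split => //; exact: osim_symmetric LX (is_diag_symmetric dL).
  by move=> z; rewrite -(osim_char_poly LA) (osim_char_poly LX).
split=> //.
have [U [oU _ dU]] := block_spectral sX (cls_block sX).
have XU : osim X (U *m X *m U^T) by exists U.
have [z|s zs] := @osim_diag_perm_eq R n (diagv L) (diagv (U *m X *m U^T)).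
  rewrite !diag_mx_diagv// (osim_char_poly LA) -(osim_char_poly XU); exact: AX.
apply: osim_trans (osim_sym XU); rewrite -(diag_mx_diagv dU) -{1}(diag_mx_diagv dL).
rewrite (_ : diagv (U *m X *m U^T) = \row_i diagv L 0 (s i)).
  exact: osim_diag_perm.
by apply/rowP => i; rewrite zs [RHS]mxE.
Qed.

Lemma schur_horn_M_quot d L : S_set d L -> M_quot d (schur_horn d L).
Proof.
move=> SL; have [oP dP] := xget_horn_mx SL.
eexists; last by []; split => //.
apply: (@osim_symmetric _ _ L); last exact: is_diag_symmetric SL.1.
by eexists; [exact: oP |].
Qed.

Lemma orthogonal_uniform (F : R -> 'M[R]_n -> Prop) :
  (forall r s Q, s <= r -> F r Q -> F s Q) ->
  (forall Q0, orthogonal_mx Q0 -> exists2 r, 0 < r &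
     forall Q, orthogonal_mx Q -> frob_norm (Q - Q0) < r -> F r Q) ->
  exists2 r, 0 < r & forall Q, orthogonal_mx Q -> F r Q.
Proof.
move=> mono loc.
have /compact_near_coveringP := @orthogonal_compact R n.
(* Compactness as a covering statement, for the filter of positive radii tending to 0. *)
move=> /(_ R (0^'+) (fun r Q => orthogonal_mx Q -> F r Q) _)[|r0 [r00 Fr0]] => [Q0 oQ0|].
  have [r r0 Fr] := loc Q0 oQ0.
  exists ([set Q | frob_norm (Q - Q0) < r], [set s | s <= r]).
    split; last exact: nbhs_right_le.
    apply/nbhs_ballP; exists (r / (n%:R + 1)) => /= [|Q [_ QQ0]].
      by rewrite divr_gt0// ltr_wpDl.
    apply: (@le_lt_trans _ _ (n%:R * (r / (n%:R + 1)))).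
      apply: frob_le_entries => [|i j]; first by rewrite divr_ge0 ?addr_ge0// ltW.
      by rewrite !mxE distrC ltW//; exact: QQ0.
    by rewrite mulrCA gtr_pMr// ltr_pdivrMr ?ltr_wpDl// mul1r ltrDl.
  by move=> [Q s] /= [Qr sr] oQ; apply: mono sr _; exact: Fr.
exists (r0 / 2) => [|Q oQ]; first by rewrite divr_gt0.
apply: (Fr0 (r0 / 2)) => //; last by rewrite divr_gt0.
have r00' : 0 < r0 by [].
by rewrite /= sub0r normrN gtr0_norm ?divr_gt0//; lra.
Qed.

Lemma frob_conj_lip L Q Q0 : orthogonal_mx Q -> orthogonal_mx Q0 ->
  frob_norm (Q *m L *m Q^T - Q0 *m L *m Q0^T)
    <= frob_norm (Q - Q0) * (2 * frob_norm L).
Proof.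
move=> oQ oQ0.
have -> : Q *m L *m Q^T - Q0 *m L *m Q0^T =
    (Q - Q0) *m L *m Q^T + Q0 *m (L *m (Q - Q0)^T).
  by rewrite mulmxBl mulmxBl linearB/= mulmxBr mulmxBr !mulmxA addrA subrK.
apply: le_trans (frobD _ _) _.
rewrite frob_mulmxr; last exact: orthogonal_mxT.
rewrite (frob_mulmxl _ oQ0).
have := frob_mulmx (Q - Q0) L; have := frob_mulmx L (Q - Q0)^T; rewrite frob_tr; lra.
Qed.

(* [E] holds throughout when it holds near the matrices with diagonal [d]: away
   from them the diagonal condition fails outright. *)
Lemma horn_uniform d L (E : 'M[R]_n -> 'M[R]_n -> Prop) :
  (forall Q0, orthogonal_mx Q0 -> diagv (Q0 *m L *m Q0^T) = d ->
     exists2 r, 0 < r & forall L' Q, S_set d L' -> orthogonal_mx Q ->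
       frob_norm (L' - L) < r ->
       frob_norm (Q *m L *m Q^T - Q0 *m L *m Q0^T) < r -> E L' Q) ->
  exists2 r, 0 < r & forall L' Q, S_set d L' -> orthogonal_mx Q ->
    frob_norm (L' - L) < r ->
    diagv (Q *m L *m Q^T) = d \/ diagv (Q *m L' *m Q^T) = d -> E L' Q.
Proof.
move=> loc.
pose F r Q := forall L', S_set d L' -> frob_norm (L' - L) < r ->
    diagv (Q *m L *m Q^T) = d \/ diagv (Q *m L' *m Q^T) = d -> E L' Q.
suff [r r0 Fr] : exists2 r, 0 < r & forall Q, orthogonal_mx Q -> F r Q.
  by exists r => // L' Q SL' oQ; exact: Fr.
apply: orthogonal_uniform => [r s Q sr Fr L' SL' L's|Q0 oQ0].
  by apply: Fr => //; exact: lt_le_trans sr.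
(* The Lipschitz constant of [Q] acting on [L], plus 1 to leave room for replacing [L] by [L']. *)
pose c := 2 * frob_norm L + 1.
have c0 : 0 < c by rewrite ltr_wpDl// mulr_ge0// frob_ge0.
have c1 : 1 <= c by rewrite lerDr mulr_ge0// frob_ge0.
have near_conj r Q : orthogonal_mx Q -> frob_norm (Q - Q0) < r / c ->
    frob_norm (Q *m L *m Q^T - Q0 *m L *m Q0^T) + r / c <= r.
  move=> oQ Qr; rewrite -[leRHS](divfK (lt0r_neq0 c0)) [in leRHS]/c mulrDr mulr1 lerD2r.
  apply: le_trans (frob_conj_lip L oQ oQ0) _; rewrite ler_wpM2r ?mulr_ge0 ?frob_ge0//.
  exact: ltW.
have [dA|dA] := pselect (diagv (Q0 *m L *m Q0^T) = d).
  have [r r0 Er] := loc Q0 oQ0 dA.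
  have rc0 : 0 < r / c by rewrite divr_gt0.
  exists (r / c) => // Q oQ Qr L' SL' L'r _.
  apply: Er => //; last by have := near_conj r Q oQ Qr; lra.
  by apply: lt_le_trans L'r _; rewrite ler_pdivrMr// ler_peMr// ltW.
have [i iA] : exists i, (Q0 *m L *m Q0^T) i i != d 0 i.
  apply: contrapT => none; apply: dA; apply/rowP => i; rewrite mxE.
  by apply: contrapT => /eqP iA; apply: none; exists i.
pose g := `|(Q0 *m L *m Q0^T) i i - d 0 i|.
have g0 : 0 < g by rewrite normr_gt0 subr_eq0.
have gc0 : 0 < g / c by rewrite divr_gt0.
have far X : frob_norm (X - Q0 *m L *m Q0^T) < g -> diagv X <> d.
  move=> Xg Xd; move: Xg; apply/negP; rewrite -leNgt /g -Xd [diagv X _ _]mxE distrC.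
  by apply: le_trans (ler_norm_frob _ i i); rewrite [X in _ <= `|X|]mxE [X in _ <= `|_ + X|]mxE.
exists (g / c) => // Q oQ Qg L' SL' L'g; have := near_conj g Q oQ Qg => Qc.
case=> Xd; exfalso; apply: (far _ _ Xd); first lra.
apply: le_lt_trans (frob_tri (Q *m L *m Q^T) _ _) _.
rewrite conj_mxB frob_conj//; lra.
Qed.

(** The first half needs [local_lift] at each point of the fibre over [L]; for the second, the
    nearby point [Q0] of that fibre already gives [X]. *)
Lemma horn_fibers_close d L : S_set d L -> forall e : R, 0 < e ->
  exists2 r : R, 0 < r & forall L', S_set d L' -> frob_norm (L' - L) < r ->
    (forall X, osim L X -> diagv X = d -> exists Y,
       [/\ osim L' Y, diagv Y = d & frob_norm (Y - X) < e]) /\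
    (forall Y, osim L' Y -> diagv Y = d -> exists X,
       [/\ osim L X, diagv X = d & frob_norm (Y - X) < e]).
Proof.
move=> SL e e0; have dL := SL.1.
have e2 : 0 < e / 2 by rewrite divr_gt0.
have [Q0 oQ0 d0|r1 r10 lower] := @horn_uniform d L (fun L' Q => exists Y,
    [/\ osim L' Y, diagv Y = d & frob_norm (Y - Q *m L *m Q^T) < e]).
  have LA : osim L (Q0 *m L *m Q0^T) by exists Q0.
  have sA := osim_symmetric LA (is_diag_symmetric dL).
  have [r r0 lift] := local_lift sA d0 dL LA e2.
  exists (Num.min r (e / 2)) => [|L' Q SL' oQ]; first by rewrite lt_min r0.
  rewrite !lt_min => /andP[L'r _] /andP[_ Qe].
  have [Y [L'Y Yd YA]] := lift L' SL' L'r.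
  exists Y; split => //; apply: le_lt_trans (frob_tri (Q0 *m L *m Q0^T) _ _) _.
  by rewrite [X in _ + X]frobC; lra.
have [Q0 oQ0 d0|r2 r20 upper] := @horn_uniform d L (fun L' Q => exists X,
    [/\ osim L X, diagv X = d & frob_norm (Q *m L' *m Q^T - X) < e]).
  exists (e / 2) => // L' Q SL' oQ L'e Qe.
  exists (Q0 *m L *m Q0^T); split => //; first by exists Q0.
  apply: le_lt_trans (frob_tri (Q *m L *m Q^T) _ _) _.
  rewrite conj_mxB frob_conj//; lra.
exists (Num.min r1 r2) => [|L' SL']; first by rewrite lt_min r10.
rewrite lt_min => /andP[L'1 L'2]; split => [X [Q oQ ->] dX|Y [Q oQ ->] dY].
  by apply: lower => //; left.
by apply: upper => //; right.
Qed.

Lemma hausdorff_dist_le (C1 C2 : set 'M[R]_n) (e : R) :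
  (forall X, C1 X -> exists2 Y, C2 Y & frob_norm (X - Y) <= e) ->
  (forall Y, C2 Y -> exists2 X, C1 X & frob_norm (X - Y) <= e) ->
  (hausdorff_dist C1 C2 <= e%:E)%E.
Proof.
move=> H1 H2; rewrite /hausdorff_dist ge_max; apply/andP; split.
  apply: ub_ereal_sup => _ [X C1X <-]; have [Y C2Y XY] := H1 X C1X.
  apply: (@le_trans _ _ (frob_norm (X - Y))%:E); last by rewrite lee_fin.
  by apply: ereal_inf_lbound; exists Y.
apply: ub_ereal_sup => _ [Y C2Y <-]; have [X C1X XY] := H2 Y C2Y.
apply: (@le_trans _ _ (frob_norm (X - Y))%:E); last by rewrite lee_fin.
  by apply: ereal_inf_lbound; exists X.
Qed.

End Continuity.

Theorem corollary1p4 (R : realType) (n : nat) (d : 'rV[R]_n) :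
  set_fun (S_set d) (M_quot d) (schur_horn d) /\
  (forall L : 'M[R]_n, S_set d L ->
   forall eps : R, 0 < eps ->
   exists2 delta : R, 0 < delta &
     forall L' : 'M[R]_n, S_set d L' -> frob_norm (L' - L) < delta ->
       (hausdorff_dist (schur_horn d L') (schur_horn d L) < eps%:E)%E).
Proof.
split=> [L SL|L SL e e0]; first exact: schur_horn_M_quot.
(* Suprema preserve only weak inequalities, hence the half. *)
have e2 : 0 < e / 2 by rewrite divr_gt0.
have [r r0 close] := horn_fibers_close SL e2.
exists r => // L' SL' /(close L' SL')[lower upper].
apply: (@le_lt_trans _ _ (e / 2)%:E); last by rewrite lte_fin; lra.
apply: hausdorff_dist_le => [Y|X] /schur_hornE => /(_ ltac:(assumption))[].
  move=> L'Y Yd; have [X [LX Xd /ltW YX]] := upper Y L'Y Yd.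
  by exists X => //; apply/schur_hornE.
move=> LX Xd; have [Y [L'Y Yd /ltW YX]] := lower X LX Xd.
by exists Y => //; apply/schur_hornE.
Qed.
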